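(* Let $d\ge3$. There exists $C\in\mathcal{C}^d_{ar}$ with the following properties: (1) $\mu_C$ is singular with respect to $\lambda_d$, has no point masses, and has full support $\mathbb{I}^d$; (2) for $\mu_{C^{1:d-1}}$-almost every $\mathbf{x}\in\mathbb{I}^{d-1}$ the conditional distribution function $y\mapsto K_C(\mathbf{x},[0,y])$ is continuous, strictly increasing and singular; (3) every level set $L_t=\{\mathbf{u}\in\mathbb{I}^d:C(\mathbf{u})=t\}$, $t\in\mathbb{I}$, satisfies $\mu_C(L_t)=0$; (4) the Kendall distribution function $F_K^d$ of $C$ is continuous, strictly increasing and singular.
   Context: $\mathbb{I}=[0,1]$. $\mathcal{C}^d_{ar}$ is the class of $d$-dimensional Archimedean copulas $C(\mathbf{u})=\psi(\sum_{i=1}^d\varphi(u_i))$, where $\psi:[0,\infty)\to\mathbb{I}$ is continuous, non-increasing, $\psi(0)=1$, $\lim_{z\to\infty}\psi(z)=0$, strictly decreasing on $[0,\inf\{z:\psi(z)=0\}]$, $\psi(1)=1/2$, with $(-1)^{d-2}\psi^{(d-2)}$ existing, non-negative, non-increasing and convex on $(0,\infty)$; $\varphi$ is the pseudo-inverse. $\mu_C$ is the measure of $C$; $C^{1:d-1}(\mathbf{x})=C(\mathbf{x},1)$; $K_C$ is the $(d-1)$-Markov kernel (regular conditional distribution of the last coordinate given the first $d-1$). A continuous distribution function is singular if its derivative is $0$ Lebesgue-a.e. $F_K^d(t)=\mu_C(\{\mathbf{u}:C(\mathbf{u})\le t\})$ is the Kendall distribution function. *)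

(* Defs.v *)
From HB Require Import structures.
From mathcomp Require Import all_boot all_order all_algebra.
From mathcomp Require Import all_classical all_reals all_analysis.
Unset Printing Implicit Defensive.
Import Order.TTheory GRing.Theory Num.Theory.
Import numFieldNormedType.Exports.
Local Open Scope classical_set_scope.
Local Open Scope ring_scope.

Section Defs.
Variable R : realType.

Definition coord_gen (n : nat) : set (set ('I_n -> R)) :=
  [set E | exists (i : 'I_n) (A : set R), measurable A /\ E = (fun u => u i) @^-1` A].

Definition Rn (n : nat) := g_sigma_algebraType (coord_gen n).

Definition cube01 {n : nat} : set (Rn n) := [set u | forall i, 0 <= u i <= 1].

Definition init {n : nat} (u : Rn n) : Rn n.-1 :=
  fun i => u (widen_ord (leq_pred n) i).

Definition lastc {n : nat} : Rn n -> R :=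
  match n as m return Rn m -> R with
  | 0 => fun _ => 0
  | m.+1 => fun u => u ord_max
  end.

Definition gen_zero (psi : R -> R) : \bar R :=
  ereal_inf [set z%:E | z in [set z | 0 <= z /\ psi z = 0]].

Definition arch_phi (psi : R -> R) (t : R) : \bar R :=
  ereal_inf [set z%:E | z in [set z | 0 <= z /\ psi z = t]].

Definition psi_ext (psi : R -> R) (x : \bar R) : R :=
  match x with EFin r => psi r | +oo%E => 0 | -oo%E => 1 end.

Definition arch_copula {d : nat} (psi : R -> R) (u : Rn d) : R :=
  psi_ext psi (\sum_(i < d) arch_phi psi (u i))%E.

Definition arch_gen (d : nat) (psi : R -> R) : Prop :=
  [/\ (forall z, 0 <= z -> 0 <= psi z <= 1),
      {within [set z | 0 <= z], continuous psi},
      (forall x y, 0 <= x -> x <= y -> psi y <= psi x),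
      psi 0 = 1 &
      psi x @[x --> +oo] --> 0 ] /\
  [/\ (forall x y, 0 <= x -> x < y -> (y%:E <= gen_zero psi)%E -> psi y < psi x),
      psi 1 = 2^-1 &
      (forall j, (j < d - 2)%N -> forall x, 0 < x -> derivable (derive1n j psi) x 1) ] /\
  let g := fun x => (-1) ^+ (d - 2) * derive1n (d - 2) psi x in
  [/\ (forall x, 0 < x -> 0 <= g x),
      (forall x y, 0 < x -> x <= y -> g y <= g x) &
      (forall x y t, 0 < x -> 0 < y -> 0 <= t <= 1 ->
         g (t * x + (1 - t) * y) <= t * g x + (1 - t) * g y) ].

Definition is_measure_of (d : nat) (C : Rn d -> R) (mu : probability (Rn d) R) :=
  forall u : Rn d, cube01 u -> mu [set v : Rn d | forall i, 0 <= v i <= u i] = (C u)%:E.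

Definition leb_null {n : nat} (A : set (Rn n)) : Prop :=
  forall e : R, 0 < e -> exists a b : nat -> 'I_n -> R,
    [/\ (forall k i, a k i <= b k i),
        A `<=` \bigcup_k [set v | forall i, a k i <= v i <= b k i] &
        (\sum_(0 <= k <oo) ((\prod_(i < n) (b k i - a k i))%:E) <= e%:E)%E ].

Definition singular_leb (n : nat) (mu : probability (Rn n) R) : Prop :=
  exists N : set (Rn n), [/\ measurable N, leb_null N & mu (~` N) = 0%E].

Definition full_support01 (n : nat) (mu : probability (Rn n) R) : Prop :=
  forall u : Rn n, cube01 u -> forall e : R, 0 < e ->
    (0 < mu [set v : Rn n | forall i, (`|v i - u i| < e)%R])%E.

Definition markov_kernel_of (n : nat) (mu : probability (Rn n) R)
    (K : R.-pker (Rn n.-1) ~> R) : Prop :=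
  forall (A : set (Rn n.-1)) (B : set R), measurable A -> measurable B ->
    mu [set u | A (init u) /\ B (lastc u)] =
    (\int[pushforward mu (@init n)]_(x in A) K x B)%E.

Definition ae_marg (n : nat) (mu : probability (Rn n) R) (P : Rn n.-1 -> Prop) :=
  exists N : set (Rn n.-1),
    [/\ measurable N, mu (@init n @^-1` N) = 0%E & forall x, ~ N x -> P x].

Definition cont_strict_singular (F : R -> R) : Prop :=
  [/\ continuous F,
      (forall x y, 0 <= x -> x < y -> y <= 1 -> F x < F y) &
      {ae (@lebesgue_measure R), forall y : R, is_derive y (1 : R) F (0 : R)} ].

Definition level_set (d : nat) (C : Rn d -> R) (t : R) : set (Rn d) :=
  [set u | cube01 u /\ C u = t].

Definition kendall_df (d : nat) (mu : probability (Rn d) R) (C : Rn d -> R) (t : R) : R :=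
  fine (mu [set u | cube01 u /\ C u <= t]).

End Defs.

Arguments arch_gen {R}.
Arguments is_measure_of {R d}.
Arguments singular_leb {R n}.
Arguments full_support01 {R n}.
Arguments markov_kernel_of {R n}.
Arguments ae_marg {R n}.
Arguments cont_strict_singular {R}.
Arguments level_set {R d}.
Arguments kendall_df {R d}.
Arguments arch_copula {R d}.
Arguments cube01 {R n}.
Arguments init {R n}.
Arguments lastc {R n}.
Arguments leb_null {R n}.
Arguments gen_zero {R}.
Arguments arch_phi {R}.
Arguments psi_ext {R}.

(* Main.v *)
(** A finite measure [rho] on the half-line with continuous, strictly decreasing
    tail [G z = rho [z, +oo[] determines a (d-1)-fold iterated tail integral
    [psi0] of [G], whose derivative of order [d - 2] is, up to sign, the tail
    integral of [G]: convex, as [G] is nonincreasing.  Let [(x, r)] be distributed as the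
    product of (d-1)-dimensional Lebesgue measure and [rho], restricted to
    [x >= 0, sum x <= r].  Then
    [(x_1, ..., x_(d-1), r - sum x)] has survival function [psi0 (sum z)], so
    that its image under [psi0] has the Archimedean copula as distribution
    function.  The value of the copula at this point is [psi0 r], and the last
    coordinate given the others has conditional distribution function
    [G (s + phi0 y) / G s] with [s = sum x]; hence continuity, strict
    monotonicity and singularity of [G] pass to the Kendall distribution
    function and to the kernel, and [mu] lives on the null set of the [u] with
    [sum (phi0 (u_i))] in a Lebesgue-null carrier of [rho].

    [rho] is a weighted sum of Cantor measures placed in a countable family of
    intervals.  The weight of the i-th one is so small compared with the width
    of the gaps at its i-th stage that off the i-th stage, whose lengths are
    summable, it contributes a Lipschitz constant at most [2 ^- i] at each
    point: by Borel-Cantelli, [G' = 0] almost everywhere. *)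
Require Import Defs.
From HB Require Import structures.
From mathcomp Require Import all_boot all_order all_algebra.
From mathcomp Require Import all_classical all_reals all_analysis.
From mathcomp Require Import measurable_realfun ring lra.
Import Order.TTheory GRing.Theory Num.Theory.
Import numFieldNormedType.Exports.
Local Open Scope classical_set_scope.
Local Open Scope ring_scope.

Set Implicit Arguments.
Unset Strict Implicit.
Unset Printing Implicit Defensive.

(** * The Cantor function *)

(** Only [rho] is chosen: iterated tail integration yields the shape conditions on a generator for
    any nonincreasing positive tail with enough decay, so each property of the copula becomes a
    property of [G]. Compared with the usual product of a radius and a uniform point of a simplex,
    [rho] is the radial law divided by the volume of the simplex [sum x <= r]; no power of [r] ever
    appears, and total mass one reads [psi0 0 = 1]. Two demands on [G] compete: strict decrease puts
    mass into every interval, singularity wants almost every point to see almost none. Choosing each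
    weight after the gaps of its Cantor set reconciles them. An exponential factor in the weights
    gives [G z <= A * expR (- z)], a bound that tail integration reproduces, so that all [d - 1]
    integrations converge. Null sets are carried over by Lipschitz estimates for [psi0] on the
    half-line instead of changes of variables: on the line for the distribution functions, through a
    grid of boxes for the carrier of [mu]. The kernel is an arbitrary version, known for each [y]
    only up to a null set depending on [y], so it is pinned down at rational [y] first. *)

Lemma geometric_small (R : realType) (a q e : R) : 0 <= a -> 0 <= q < 1 -> 0 < e ->
  exists N, forall k, (N <= k)%N -> a * q ^+ k <= e.
Proof.
move=> a0 /andP[q0 q1] e0; have nq : `|q| < 1 by rewrite ger0_norm.
have /cvgrPdist_le /(_ _ e0)[N _ h] := @cvg_geometric R a q nq.
exists N => k /h.
by rewrite sub0r normrN /geometric /= ger0_norm ?mulr_ge0 ?exprn_ge0.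
Qed.

Section Cantor.
Variable R : realType.
Implicit Types (x y : R) (k : nat).

(** The Cantor function, extended by 0 and 1, is a fixed point of this averaging over the two halves
    of the Cantor set. Iterating from the indicator of [0 < x] gives a nonincreasing sequence, so
    the limit exists pointwise by monotonicity. *)
Definition cantor_step (f : R -> R) x := (f (3 * x) + f (3 * x - 2)) / 2.

Definition cantor_approx k : R -> R :=
  iter k cantor_step (fun x => if 0 < x then 1 else 0).

Lemma cantor_approx_itv k x : 0 <= cantor_approx k x <= 1.
Proof.
elim: k x => [x|k IH x] /=; first by case: ifP; lra.
have := IH (3 * x); have := IH (3 * x - 2); rewrite /cantor_step -/(cantor_approx k); lra.
Qed.

Lemma cantor_approx_le0 k x : x <= 0 -> cantor_approx k x = 0.
Proof.
elim: k x => [x x0|k IH x x0] /=; first by rewrite ltNge x0.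
by rewrite /cantor_step -/(cantor_approx k) !IH ?addr0 ?mul0r//; lra.
Qed.

Lemma cantor_approx_ge1 k x : 1 <= x -> cantor_approx k x = 1.
Proof.
elim: k x => [x x0|k IH x x0] /=; first by rewrite (lt_le_trans ltr01 x0).
by rewrite /cantor_step -/(cantor_approx k) !IH; lra.
Qed.

Lemma cantor_approx_nd k x y : x <= y -> cantor_approx k x <= cantor_approx k y.
Proof.
elim: k x y => [|k IH] x y xy /=.
  by case: ifPn => [x0|_]; [rewrite (lt_le_trans x0 xy)|case: ifP].
have h1 : 3 * x <= 3 * y by lra.
have h2 : 3 * x - 2 <= 3 * y - 2 by lra.
have := IH _ _ h1; have := IH _ _ h2; rewrite /cantor_step -/(cantor_approx k); lra.
Qed.

Lemma cantor_approx_decr x : nonincreasing_seq (cantor_approx ^~ x).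
Proof.
apply/nonincreasing_seqP => k; elim: k x => [|k IH] x /=.
  rewrite /cantor_step; case: ifP => x0; case: ifP; case: ifP; lra.
have := IH (3 * x); have := IH (3 * x - 2).
rewrite /= /cantor_step -/(cantor_approx k); lra.
Qed.

Definition cantor x : R := limn (cantor_approx ^~ x).

Lemma cvg_cantor_approx x : cantor_approx k x @[k --> \oo] --> cantor x.
Proof.
apply: nonincreasing_is_cvgn; first exact: cantor_approx_decr.
by exists 0 => _ [k _ <-]; case/andP: (cantor_approx_itv k x).
Qed.

Lemma cantor_itv x : 0 <= cantor x <= 1.
Proof.
apply/andP; split.
  apply: limr_ge; first by apply/cvg_ex; exists (cantor x); exact: cvg_cantor_approx.
  by apply: nearW => k; case/andP: (cantor_approx_itv k x).
apply: limr_le; first by apply/cvg_ex; exists (cantor x); exact: cvg_cantor_approx.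
by apply: nearW => k; case/andP: (cantor_approx_itv k x).
Qed.

Lemma cantor_le0 x : x <= 0 -> cantor x = 0.
Proof.
move=> x0; apply: cvg_lim => //; rewrite (_ : (fun k => _) = cst 0); first exact: cvg_cst.
by apply/funext => k; exact: cantor_approx_le0.
Qed.

Lemma cantor_ge1 x : 1 <= x -> cantor x = 1.
Proof.
move=> x0; apply: cvg_lim => //; rewrite (_ : (fun k => _) = cst 1); first exact: cvg_cst.
by apply/funext => k; exact: cantor_approx_ge1.
Qed.

Lemma cantor_nd : {homo cantor : x y / x <= y}.
Proof.
move=> x y xy; apply: ler_lim.
- by apply/cvg_ex; exists (cantor x); exact: cvg_cantor_approx.
- by apply/cvg_ex; exists (cantor y); exact: cvg_cantor_approx.
- by apply: nearW => k; exact: cantor_approx_nd.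
Qed.

Lemma cantorE x : cantor x = (cantor (3 * x) + cantor (3 * x - 2)) / 2.
Proof.
have h1 : cantor_approx k.+1 x @[k --> \oo] --> cantor x.
  by rewrite (cvg_shiftS (cantor_approx ^~ x)); exact: cvg_cantor_approx.
rewrite -(cvg_lim (@Rhausdorff R) h1); apply: cvg_lim; first exact: Rhausdorff.
by apply: cvgMl; apply: cvgD; exact: cvg_cantor_approx.
Qed.

Lemma cantor_holder k x y : `|x - y| <= 3 ^- k -> `|cantor x - cantor y| <= 2 ^- k.
Proof.
wlog xy : x y / x <= y.
  move=> h; have [/h//|/ltW yx] := leP x y.
  by rewrite distrC => /(h _ _ yx); rewrite distrC.
rewrite -[`|x - y|]distrC -[`|cantor x - _|]distrC !ger0_norm ?subr_ge0 ?cantor_nd//.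
elim: k x y xy => [|k IH] x y xy.
  by rewrite !expr0 !invr1 => _; have := cantor_itv x; have := cantor_itv y; lra.
rewrite !exprS !invfM => h.
have h3 : 3 * y - 3 * x <= 3 ^- k by move: h; set t := 3 ^- k; lra.
have h3' : 3 * y - 2 - (3 * x - 2) <= 3 ^- k by move: h3; lra.
have k1 : (3:R) ^- k <= 1 by rewrite invf_le1 ?exprn_gt0// exprn_ege1//; lra.
have le3 : 3 * x <= 3 * y by lra.
have le3' : 3 * x - 2 <= 3 * y - 2 by lra.
have H1 := IH _ _ le3 h3; have H2 := IH _ _ le3' h3'.
rewrite (cantorE x) (cantorE y).
(* Since [y - x <= 1/3], one of the two summands takes the same value at [x] and [y]; only the other
   varies, and the division by 2 supplies the missing factor. *)
have [y2|y2] := leP y (2/3).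
  by rewrite (@cantor_le0 (3 * y - 2)) 1?(@cantor_le0 (3 * x - 2)); lra.
by rewrite (@cantor_ge1 (3 * y)) 1?(@cantor_ge1 (3 * x)); lra.
Qed.

Lemma cantor_continuous : continuous cantor.
Proof.
move=> x; apply/cvgrPdist_le => e e0.
have half : 0 <= (2^-1 : R) < 1 by lra.
have [k /(_ k (leqnn k))] := geometric_small ler01 half e0.
rewrite mul1r exprVn => ke.
near=> t; apply: le_trans ke; apply: cantor_holder.
near: t; apply: (@cvgr_dist_le _ _ _ _ _ id x) => //.
Unshelve. all: by end_near. Qed.

(** Left ends of the intervals of the [k]-th Cantor stage, each enlarged on both sides by its own
    length [3 ^- k]: stage 0 is [[-1, 2]] instead of [[0, 1]]. This margin keeps the Cantor function
    constant on a whole [3 ^- k]-neighbourhood of a point off the cover. *)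
Fixpoint cantor_ends k : seq R :=
  if k is j.+1 then
    [seq a / 3 | a <- cantor_ends j] ++ [seq (a + 2) / 3 | a <- cantor_ends j]
  else [:: -1].

Lemma size_cantor_ends k : size (cantor_ends k) = (2 ^ k)%N.
Proof. by elim: k => //= k IH; rewrite size_cat !size_map IH expnS mul2n addnn. Qed.

Definition cantor_cover k : set R :=
  \bigcup_(a in [set` cantor_ends k]) `[a, a + 3 * 3 ^- k]%classic.

(** A point off the cover of stage [k.+1] is sent by [3 * x] and by [3 * x - 2] off the cover of
    stage [k], while distances are tripled; the functional equation concludes. *)
Lemma cantor_locally_cst k x y : ~ cantor_cover k x -> `|y - x| <= 3 ^- k ->
  cantor y = cantor x.
Proof.
elim: k x y => [|k IH] x y nx.
  rewrite expr0 invr1 ler_norml => yx.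
  have [x1|x1] := ltP x (-1); first by rewrite !cantor_le0//; lra.
  have [x2|x2] := ltP 2 x; first by rewrite !cantor_ge1//; lra.
  exfalso; apply: nx; exists (-1); first by rewrite /= inE.
  by rewrite /= in_itv/= expr0 invr1; apply/andP; split; lra.
rewrite exprS invfM => yx; rewrite (cantorE x) (cantorE y).
have e1 : `|3 * y - 3 * x| <= 3 ^- k.
  rewrite -mulrBr normrM ger0_norm//; move: yx; set t := 3 ^- k; lra.
have e2 : `|3 * y - 2 - (3 * x - 2)| <= 3 ^- k.
  by rewrite (_ : 3 * y - 2 - (3 * x - 2) = 3 * y - 3 * x)//; lra.
rewrite (IH (3 * x) (3 * y)) // ?(IH (3 * x - 2) (3 * y - 2)) //.
- move=> [a /= ak]; rewrite in_itv/= => xa; apply: nx; exists ((a + 2) / 3) => /=.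
    by rewrite mem_cat; apply/orP; right; apply/mapP; exists a.
  by rewrite in_itv/= exprS invfM; move: xa; set t := 3 ^- k; lra.
- move=> [a /= ak]; rewrite in_itv/= => xa; apply: nx; exists (a / 3) => /=.
    by rewrite mem_cat; apply/orP; left; apply/mapP; exists a.
  by rewrite in_itv/= exprS invfM; move: xa; set t := 3 ^- k; lra.
Qed.

End Cantor.

(** * A singular tail function *)

Section StieltjesContinuous.
Variables (R : realType) (f : cumulativeBounded (0 : R) (1 : R)).
Hypothesis cf : continuous f.
Let mu := lebesgue_stieltjes_measure f.

Lemma lebesgue_stieltjes_itvoc (a b : R) : a <= b -> mu `]a, b] = (f b - f a)%:E.
Proof.
move=> ab; rewrite /mu/= /lebesgue_stieltjes_measure /measure_extension/=.
by rewrite measurable_mu_extE/= ?wlength_itv_bnd//; exact: is_ocitv.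
Qed.

Lemma lebesgue_stieltjes_set1 (z : R) : mu [set z] = 0%E.
Proof.
apply/eqP; rewrite eq_le measure_ge0 andbT; apply/lee_addgt0Pr => e e0.
rewrite add0e.
have /cvgrPdist_le /(_ _ e0) H := @cf z.
have [y [yz /= fy]] : exists y, y < z /\ `|f z - f y| <= e.
  have : \forall y \near z^'-, `|f z - f y| <= e by apply: cvg_within H.
  have : \forall y \near z^'-, y < z by exact: nbhs_left_lt.
  move=> h1 h2; have [y [? ?]] := filter_ex (filterI h1 h2).
  by exists y.
apply: (@le_trans _ _ (mu `]y, z])).
  by apply: le_measure; rewrite ?inE//= => t -> /=; rewrite in_itv/= yz lexx.
rewrite lebesgue_stieltjes_itvoc ?(ltW yz)// lee_fin.
by rewrite (le_trans _ fy)// ler_norm.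
Qed.

Lemma lebesgue_stieltjes_itvNyc (z : R) : mu `]-oo, z] = (f z)%:E.
Proof.
by rewrite -cdf_lebesgue_stieltjes_id/= /cdf/= /distribution/= /pushforward preimage_id.
Qed.

Lemma lebesgue_stieltjes_itvcy (z : R) : mu `[z, +oo[ = (1 - f z)%:E.
Proof.
have -> : `[z, +oo[%classic = ~` `]-oo, z] `|` [set z] :> set R.
  apply/seteqP; split => x /=; rewrite !in_itv/= ?andbT.
    by rewrite le_eqVlt => /orP[/eqP ->|zx]; [right|left; rewrite leNgt zx].
  by move=> [/negP|->//]; rewrite -ltNge => /ltW.
rewrite [LHS]measureU; last 3 first.
- exact: measurableC.
- exact: measurable_set1.
- by apply/seteqP; split => x //= [] /[swap] -> /=; rewrite in_itv/= lexx; exact.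
rewrite [X in (_ + X)%E = _]lebesgue_stieltjes_set1 adde0.
by rewrite [LHS]probability_setC// [X in (_ - X)%E = _]lebesgue_stieltjes_itvNyc.
Qed.

End StieltjesContinuous.

(** * Weighted Cantor measures on a countable family of cells *)

Section SingularTail.
Variable R : realType.
Implicit Types (x y z : R) (i k n : nat).
Notation leb := (@lebesgue_measure R).

(** Decodes [i] into [(j, k)]; the cell is then [[j / k.+1, j.+1 / k.+1]]. A number that decodes to
    nothing repeats the cell [[0, 1]], which is harmless: only the occurrence of every cell
    matters. *)
Definition grid_index i : nat * nat := odflt (0%N, 0%N) (unpickle i).
Definition grid_len i : R := (grid_index i).2.+1%:R^-1.
Definition grid_left i : R := (grid_index i).1%:R * grid_len i.
Definition grid_cantor i x := cantor ((x - grid_left i) / grid_len i).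

Lemma grid_len_gt0 i : 0 < grid_len i.
Proof. by rewrite invr_gt0 ltr0n. Qed.

Lemma grid_len_le1 i : grid_len i <= 1.
Proof. by rewrite invf_le1 ?ltr0n// ler1n. Qed.

Lemma grid_left_ge0 i : 0 <= grid_left i.
Proof. by rewrite mulr_ge0// ltW// grid_len_gt0. Qed.

Lemma grid_fits x y : 0 <= x -> x < y ->
  exists i, x <= grid_left i /\ grid_left i + grid_len i <= y.
Proof.
move=> x0 xy.
(* The mesh [1 / k.+1] is below [(y - x) / 2] and [j / k.+1] is the first grid point beyond [x], so
   the cell that starts there ends before [y]. *)
pose k := Num.truncn (2 / (y - x)); pose j := (Num.truncn (x * k.+1%:R)).+1.
have e : grid_index (pickle (j, k)) = (j, k) by rewrite /grid_index pickleK.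
exists (pickle (j, k)); rewrite /grid_left /grid_len e /=.
have k0 : 0 < k.+1%:R :> R by rewrite ltr0n.
have yx0 : 0 < y - x by lra.
have hk : 2 / (y - x) < k.+1%:R.
  by case/andP: (@truncn_itv R _ (divr_ge0 (ler0n _ 2) (ltW yx0))).
have /truncn_itv : 0 <= x * k.+1%:R by rewrite mulr_ge0.
rewrite -/k -[X in _ < X%:R]/j => /andP[j1 j2]; split.
  by rewrite ler_pdivlMr// ltW.
rewrite -[X in _ + X]mul1r -mulrDl ler_pdivrMr//.
move: hk; rewrite ltr_pdivrMr//.
have : j%:R <= x * k.+1%:R + 1.
  by rewrite /j -natr1 lerD2r.
lra.
Qed.

Lemma grid_cantor_nd i : {homo grid_cantor i : x y / x <= y}.
Proof.
move=> x y xy; apply: cantor_nd; rewrite ler_pM2r ?lerD2r//.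
by rewrite invr_gt0 grid_len_gt0.
Qed.

Lemma grid_cantor_continuous i : continuous (grid_cantor i).
Proof.
move=> x; apply: (@continuous_comp _ _ _ (fun t => (t - grid_left i) / grid_len i) (@cantor R)).
  by apply: cvgMl; apply: cvgB; [exact: cvg_id|exact: cvg_cst].
exact: cantor_continuous.
Qed.

Lemma grid_cantor_itv i x : 0 <= grid_cantor i x <= 1.
Proof. exact: cantor_itv. Qed.

Lemma grid_cantor_eq0 i x : x <= grid_left i -> grid_cantor i x = 0.
Proof.
move=> h; apply: cantor_le0; rewrite pmulr_lle0 ?subr_le0//.
by rewrite invr_gt0 grid_len_gt0.
Qed.

Lemma grid_cantor_eq1 i x : grid_left i + grid_len i <= x -> grid_cantor i x = 1.
Proof.
move=> h; apply: cantor_ge1; rewrite ler_pdivlMr ?grid_len_gt0//; lra.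
Qed.

Lemma grid_cantor_cvgNy i : grid_cantor i @ -oo --> (0 : R).
Proof.
apply: (@cvg_trans _ (cst (0 : R) @ -oo)); last exact: cvg_cst.
apply: near_eq_cvg; near=> x; rewrite grid_cantor_eq0//.
Unshelve. all: by end_near. Qed.

Lemma grid_cantor_cvgy i : grid_cantor i @ +oo --> (1 : R).
Proof.
apply: (@cvg_trans _ (cst (1 : R) @ +oo)); last exact: cvg_cst.
apply: near_eq_cvg; near=> x; rewrite grid_cantor_eq1//.
Unshelve. all: by end_near. Qed.

HB.instance Definition _ i := isCumulative.Build R _ R (grid_cantor i)
  (@grid_cantor_nd i) (right_continuousW (@grid_cantor_continuous i)).

HB.instance Definition _ i := isCumulativeBounded.Build R 0 1 (grid_cantor i)
  (@grid_cantor_cvgNy i) (@grid_cantor_cvgy i).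

Definition grid_law i := lebesgue_stieltjes_measure (grid_cantor i).

(* The factor [3 ^- i * grid_len i] is the scale at which the [i]-th cover
   [grid_cover i i] separates the plateaus of [grid_cantor i]; it makes the
   [i]-th summand Lipschitz with constant [2 ^- i] off that cover. *)
Definition grid_weight i : R :=
  2 ^- i * (3 ^- i * grid_len i) * expR (- (grid_left i + grid_len i)).

Lemma grid_weight_gt0 i : 0 < grid_weight i.
Proof.
by rewrite !mulr_gt0 ?expR_gt0 ?grid_len_gt0// invr_gt0 exprn_gt0.
Qed.

Let exp3_itv i : 0 < (3 : R) ^- i <= 1.
Proof. by rewrite invr_gt0 exprn_gt0//= invf_le1 ?exprn_gt0// exprn_ege1//; lra. Qed.

Let exp2_gt0 i : 0 < (2 : R) ^- i.
Proof. by rewrite invr_gt0 exprn_gt0. Qed.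

Lemma grid_weight_le_exp i : grid_weight i <= 2 ^- i * expR (- (grid_left i + grid_len i)).
Proof.
rewrite ler_pM2r ?expR_gt0// ler_piMr ?(ltW (exp2_gt0 i))//.
have := grid_len_gt0 i; have := grid_len_le1 i; have := exp3_itv i; nra.
Qed.

Lemma grid_weight_le_len i : grid_weight i <= 2 ^- i * (3 ^- i * grid_len i).
Proof.
rewrite ler_piMr//.
  by rewrite !mulr_ge0 ?ltW ?exp2_gt0 ?grid_len_gt0//; case/andP: (exp3_itv i).
by rewrite expR_le1 oppr_le0 addr_ge0 ?grid_left_ge0// ltW// grid_len_gt0.
Qed.

Lemma grid_weight_le i : grid_weight i <= 2 ^- i.
Proof.
apply: (le_trans (grid_weight_le_exp i)).
rewrite ler_piMr ?(ltW (exp2_gt0 i))//.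
by rewrite expR_le1 oppr_le0 addr_ge0 ?grid_left_ge0// ltW// grid_len_gt0.
Qed.

Definition grid_cover i k : set R :=
  [set x | cantor_cover k ((x - grid_left i) / grid_len i)].

Lemma grid_locally_cst i k x y : ~ grid_cover i k x ->
  `|y - x| <= 3 ^- k * grid_len i -> grid_cantor i y = grid_cantor i x.
Proof.
move=> nx xy; apply: (cantor_locally_cst nx).
rewrite -mulrBl (_ : y - _ - (x - _) = y - x); last by ring.
rewrite normrM [X in _ * X]gtr0_norm ?invr_gt0 ?grid_len_gt0//.
by rewrite ler_pdivrMr ?grid_len_gt0.
Qed.

(** Up to the distance [3 ^- i * grid_len i] the increment is zero; beyond it the increment is at
    most 1 and the weight is at most [2 ^- i] times that distance. *)
Lemma grid_lipschitz i x y : ~ grid_cover i i x ->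
  grid_weight i * `|grid_cantor i y - grid_cantor i x| <= 2 ^- i * `|y - x|.
Proof.
move=> nx; have [h|h] := leP `|y - x| (3 ^- i * grid_len i).
  by rewrite (grid_locally_cst nx h) subrr normr0 mulr0 mulr_ge0// ltW.
have h1 : `|grid_cantor i y - grid_cantor i x| <= 1.
  have := grid_cantor_itv i x; have := grid_cantor_itv i y.
  by rewrite ler_norml; lra.
apply: (@le_trans _ _ (grid_weight i)).
  by rewrite ler_piMr// ltW// grid_weight_gt0.
apply: (le_trans (grid_weight_le_len i)).
by rewrite ler_pM2l ?exp2_gt0// ltW.
Qed.

Definition tail_term z i : R := grid_weight i * (1 - grid_cantor i z).

Definition tail_sum z : R := limn (series (tail_term z)).

Let sum_exp2 N m : \sum_(N <= i < m) (2 : R) ^- i <= 2 * 2 ^- N.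
Proof.
have [mN|Nm] := leqP m N; first by rewrite big_geq// mulr_ge0// ltW.
suff : \sum_(N <= i < m) (2 : R) ^- i <= 2 * 2 ^- N - 2 * 2 ^- m.
  by have := exp2_gt0 m; lra.
rewrite -(subnKC (ltnW Nm)); elim: (m - N)%N => [|j IH].
  by rewrite addn0 big_geq// subrr.
rewrite addnS big_nat_recr ?leq_addr//= exprS invfM; lra.
Qed.

Lemma tail_term_ge0 z i : 0 <= tail_term z i.
Proof.
rewrite mulr_ge0 ?(ltW (grid_weight_gt0 i))//.
by have := grid_cantor_itv i z; lra.
Qed.

(** The summand vanishes once its cell lies to the left of [z]; otherwise the right end of the cell
    exceeds [z], and the exponential factor of the weight is at most [expR (- z)]. The bound by 1
    serves uniform convergence on the whole line. *)
Lemma tail_term_le z i : tail_term z i <= 2 ^- i * Num.min 1 (expR (- z)).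
Proof.
have h1 := grid_cantor_itv i z.
have [zi|zi] := leP (grid_left i + grid_len i) z.
  by rewrite /tail_term grid_cantor_eq1// subrr mulr0 mulr_ge0 ?(ltW (exp2_gt0 i))//
    le_min ler01 expR_ge0.
apply: (@le_trans _ _ (grid_weight i)).
  by rewrite ler_piMr ?(ltW (grid_weight_gt0 i))//; lra.
rewrite minr_pMr ?(ltW (exp2_gt0 i))// mulr1 le_min grid_weight_le/=.
apply: (le_trans (grid_weight_le_exp i)).
by rewrite ler_pM2l ?exp2_gt0// ler_expR lerN2 ltW.
Qed.

Lemma tail_term_le_exp2 z i : tail_term z i <= 2 ^- i.
Proof.
by apply: (le_trans (tail_term_le z i)); rewrite ler_piMr ?(ltW (exp2_gt0 i))// ge_min lexx.
Qed.

Let series_tail_le N m z : \sum_(N <= i < m) tail_term z i <= 2 * 2 ^- N.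
Proof. by apply: le_trans (sum_exp2 N m); apply: ler_sum => i _; exact: tail_term_le_exp2. Qed.

Lemma cvg_tail_sum z : series (tail_term z) n @[n --> \oo] --> tail_sum z.
Proof.
apply: nondecreasing_is_cvgn.
  by apply/nondecreasing_seqP => n; rewrite /series/= big_nat_recr//= lerDl tail_term_ge0.
by exists (2 * 2 ^- 0) => _ [n _ <-]; exact: series_tail_le.
Qed.

Lemma tail_sum_ge z n : series (tail_term z) n <= tail_sum z.
Proof.
apply: nondecreasing_cvgn_le; last by apply/cvg_ex; exists (tail_sum z); exact: cvg_tail_sum.
by apply/nondecreasing_seqP => k; rewrite /series/= big_nat_recr//= lerDl tail_term_ge0.
Qed.

Lemma tail_sum_ge0 z : 0 <= tail_sum z.
Proof. by have := tail_sum_ge z 0; rewrite /series/= big_geq. Qed.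

Lemma tail_sum_le_exp z : tail_sum z <= 2 * expR (- z).
Proof.
apply: limr_le; first by apply/cvg_ex; exists (tail_sum z); exact: cvg_tail_sum.
apply: nearW => n; apply: (@le_trans _ _ (\sum_(0 <= i < n) 2 ^- i * expR (- z))).
  apply: ler_sum => i _; apply: (le_trans (tail_term_le z i)).
  by rewrite ler_pM2l ?exp2_gt0// ge_min lexx orbT.
rewrite -mulr_suml ler_pM2r ?expR_gt0//.
by apply: (le_trans (sum_exp2 0 n)); rewrite expr0 invr1 mulr1.
Qed.

Lemma tail_sum_approx z n : `|tail_sum z - series (tail_term z) n| <= 2 * 2 ^- n.
Proof.
rewrite ger0_norm ?subr_ge0 ?tail_sum_ge// lerBlDr.
apply: limr_le; first by apply/cvg_ex; exists (tail_sum z); exact: cvg_tail_sum.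
near=> m; have nm : (n <= m)%N by near: m; exact: nbhs_infty_ge.
by rewrite /series/= (big_cat_nat (n := n))//= addrC lerD2r.
Unshelve. all: by end_near. Qed.

Lemma tail_sum_nonincr x y : x <= y -> tail_sum y <= tail_sum x.
Proof.
move=> xy; apply: ler_lim.
- by apply/cvg_ex; exists (tail_sum y); exact: cvg_tail_sum.
- by apply/cvg_ex; exists (tail_sum x); exact: cvg_tail_sum.
- apply: nearW => n; apply: ler_sum => i _.
  by rewrite ler_pM2l ?grid_weight_gt0// lerB// grid_cantor_nd.
Qed.

(** Some cell lies between [x] and [y]: its summand drops from its full weight to 0, while no other
    summand increases. *)
Lemma tail_sum_decr x y : 0 <= x -> x < y -> tail_sum y < tail_sum x.
Proof.
move=> x0 xy; have [i [xi iy]] := grid_fits x0 xy.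
suff : tail_sum y + grid_weight i <= tail_sum x by have := grid_weight_gt0 i; lra.
have hd : series (tail_term y) n + grid_weight i @[n --> \oo] --> tail_sum y + grid_weight i.
  by apply: cvgD; [exact: cvg_tail_sum|exact: cvg_cst].
rewrite -(cvg_lim (@Rhausdorff R) hd).
apply: limr_le; first by apply/cvg_ex; exists (tail_sum y + grid_weight i).
near=> n; apply: le_trans (tail_sum_ge x n).
have ni : (i < n)%N by near: n; exact: nbhs_infty_gt.
rewrite /series/= !big_mkord (bigD1 (Ordinal ni))//= [leRHS](bigD1 (Ordinal ni))//=.
rewrite /tail_term (grid_cantor_eq1 iy) (grid_cantor_eq0 xi) subrr mulr0 add0r [leLHS]addrC.
rewrite subr0 mulr1 lerD2l; apply: ler_sum => j _.
by rewrite ler_pM2l ?grid_weight_gt0// lerB// grid_cantor_nd// ltW.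
Unshelve. all: by end_near. Qed.

Lemma tail_sum_continuous : continuous tail_sum.
Proof.
move=> x; apply/cvgrPdist_le => e e0.
have e3 : 0 < e / 3 by lra.
have half : 0 <= (2^-1 : R) < 1 by lra.
have [n /(_ n (leqnn n))] := geometric_small (ler0n _ 2) half e3.
rewrite exprVn => ne.
have cn : {for x, continuous (fun t => series (tail_term t) n)}.
  rewrite /prop_for /continuous_at /series/=; elim: n {ne} => [|n IH].
    by rewrite big_geq//; under eq_fun do rewrite big_geq//; exact: cvg_cst.
  rewrite big_nat_recr//=; under eq_fun do rewrite big_nat_recr//=.
  apply: cvgD => //; apply: cvgMr.
  by apply: cvgB; [exact: cvg_cst|exact: grid_cantor_continuous].
move/cvgrPdist_le : cn => /(_ _ e3) cn.
near=> t.
have h1 := tail_sum_approx x n; have h2 := tail_sum_approx t n.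
have h3 : `|series (tail_term x) n - series (tail_term t) n| <= e / 3 by near: t.
move: h1 h2 h3; rewrite !ler_norml; lra.
Unshelve. all: by end_near. Qed.

Lemma tail_sum_lipschitz n x y :
  (forall i, (i < n)%N -> grid_cantor i y = grid_cantor i x) ->
  (forall i, (n <= i)%N -> ~ grid_cover i i x) ->
  `|tail_sum y - tail_sum x| <= 2 * 2 ^- n * `|y - x|.
Proof.
move=> lo hi.
have hd : `|series (tail_term y) m - series (tail_term x) m| @[m --> \oo] -->
    `|tail_sum y - tail_sum x|.
  by apply: cvg_norm; apply: cvgB; exact: cvg_tail_sum.
rewrite -(cvg_lim (@Rhausdorff R) hd).
apply: limr_le; first by apply/cvg_ex; exists `|tail_sum y - tail_sum x|.
near=> m; have nm : (n <= m)%N by near: m; exact: nbhs_infty_ge.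
rewrite /series/= -sumrB (big_cat_nat (n := n))//= big_nat_cond big1 ?add0r; last first.
  by move=> i /andP[/andP[_ /lo]]; rewrite /tail_term => -> _; rewrite subrr.
apply: le_trans (ler_norm_sum _ _ _) _.
apply: (@le_trans _ _ (\sum_(n <= i < m) 2 ^- i * `|y - x|)); last first.
  by rewrite -mulr_suml ler_wpM2r// sum_exp2.
rewrite big_nat_cond [leRHS]big_nat_cond; apply: ler_sum => i /andP[/andP[ni _] _].
rewrite -mulrBr (_ : 1 - _ - (1 - _) = grid_cantor i x - grid_cantor i y); last by ring.
rewrite normrM distrC gtr0_norm ?grid_weight_gt0//.
exact/grid_lipschitz/hi.
Unshelve. all: by end_near. Qed.

(** * Null covers of the Cantor sets and the derivative of the tail *)

Definition seq_cover (s : seq R) (l : R) : set R :=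
  \bigcup_(a in [set` s]) `[a, a + l]%classic.

Lemma seq_cover_measurable (s : seq R) (l : R) :
  measurable (seq_cover s l).
Proof.
by apply: fin_bigcup_measurable => // a _; exact: measurable_itv.
Qed.

Lemma seq_cover_measure (s : seq R) (l : R) : 0 <= l ->
  (leb (seq_cover s l) <= ((size s)%:R * l)%:E)%E.
Proof.
move=> l0; elim: s => [|a s IH].
  by rewrite /seq_cover bigcup_seq big_nil measure0 mul0r.
have -> : seq_cover (a :: s) l = `[a, a + l]%classic `|` seq_cover s l.
  by rewrite /seq_cover !bigcup_seq big_cons.
have mi : measurable (`[a, a + l]%classic : set R) by exact: measurable_itv.
apply: (le_trans (measureU2 leb mi (seq_cover_measurable s l))).
rewrite /= -natr1 mulrDl mul1r addrC EFinD; apply: leeD => //.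
rewrite lebesgue_measure_itv /= lte_fin ltrDl.
by case: ifP => _; rewrite lee_fin//; lra.
Qed.

Definition grid_ends i k : seq R :=
  [seq grid_left i + grid_len i * a | a <- cantor_ends R k].

Lemma grid_coverE i k : grid_cover i k =
  seq_cover (grid_ends i k) (grid_len i * (3 * 3 ^- k)).
Proof.
have l0 := grid_len_gt0 i.
rewrite /grid_cover /cantor_cover /grid_ends; move: (3 ^- k) => t.
move: (grid_left i) (grid_len i) l0 => b l l0.
apply/seteqP; split => x.
- move=> [a ak]; rewrite /= in_itv/= ler_pdivlMr// ler_pdivrMr// => h.
  exists (b + l * a); first by apply/mapP; exists a.
  by move: h; rewrite /= in_itv/= => /andP[h1 h2]; apply/andP; split; lra.
- move=> [_ /mapP[a ak ->]]; rewrite /= in_itv/= => h.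
  exists a => //=; rewrite in_itv/= ler_pdivlMr// ler_pdivrMr//.
  by case/andP: h => h1 h2; apply/andP; split; lra.
Qed.

Lemma grid_cover_measurable i k : measurable (grid_cover i k).
Proof. by rewrite grid_coverE; exact: seq_cover_measurable. Qed.

Lemma grid_cover_length i k :
  (size (grid_ends i k))%:R * (grid_len i * (3 * 3 ^- k)) <= 3 * (2 / 3) ^+ k.
Proof.
rewrite size_map size_cantor_ends natrX expr_div_n.
have := grid_len_le1 i; have := grid_len_gt0 i.
have : 0 < (2:R) ^+ k by rewrite exprn_gt0.
have := exp3_itv k.
set a := 2 ^+ k; set b := 3 ^- k; set c := grid_len i => /andP[b0 _] a0 c0 c1.
have -> : a * (c * (3 * b)) = c * (3 * (a * b)) by ring.
by rewrite ler_piMl// !mulr_ge0// ltW.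
Qed.

Lemma grid_cover_measure i k : (leb (grid_cover i k) <= (3 * (2 / 3) ^+ k)%:E)%E.
Proof.
rewrite grid_coverE; apply: le_trans (seq_cover_measure _ _) _.
  by rewrite !mulr_ge0// ?(ltW (grid_len_gt0 i))//; case/andP: (exp3_itv k) => /ltW.
by rewrite lee_fin grid_cover_length.
Qed.

(** The line is cut into countably many windows of length [3 ^- k * grid_len i]. A window that meets
    the complement of the cover has no mass at all, because [grid_cantor i] is constant at that
    distance from such a point. *)
Lemma grid_law_plateau i k : grid_law i (~` grid_cover i k) = 0%E.
Proof.
pose e := 3 ^- k * grid_len i.
have e0 : 0 < e by rewrite mulr_gt0 ?grid_len_gt0//; case/andP: (exp3_itv k).
pose J (j : int) : set R := `](j%:~R - 1) * e, j%:~R * e]%classic.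
pose F n : set R := if unpickle n is Some j then J j `\` grid_cover i k else set0.
have mF n : measurable (F n).
  rewrite /F; case: unpickle => // j; apply: measurableD; first exact: measurable_itv.
  exact: grid_cover_measurable.
have sub : ~` grid_cover i k `<=` \bigcup_n F n.
  move=> x nx; exists (pickle (Num.ceil (x / e))) => //; rewrite /F pickleK.
  split => //; rewrite /J /= in_itv/= -ler_pdivrMr// -ltr_pdivlMr//.
  by have := ceil_itv (x / e); rewrite intrB.
have F0 n : grid_law i (F n) = 0%E.
  rewrite /F; case: unpickle => [j|]; last exact: measure0.
  have [->|/set0P[x [Jx nx]]] := eqVneq (J j `\` grid_cover i k) set0; first exact: measure0.
  apply/eqP; rewrite eq_le measure_ge0 andbT.
  apply: (@le_trans _ _ (grid_law i (J j))).
    apply: le_measure; rewrite ?inE//.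
    - by apply: measurableD; [exact: measurable_itv|exact: grid_cover_measurable].
    - exact: measurable_itv.
  rewrite /J /grid_law [leLHS]lebesgue_stieltjes_itvoc ?ler_pM2r//; last by rewrite lerBlDr lerDl.
  move: Jx; rewrite /J /= in_itv/= => Jx.
  rewrite (grid_locally_cst nx); last by rewrite -/e ger0_norm; lra.
  by rewrite (@grid_locally_cst _ _ _ _ nx) ?subrr// -/e ler0_norm; lra.
apply/eqP; rewrite eq_le measure_ge0 andbT.
apply: (@le_trans _ _ (grid_law i (\bigcup_n F n))).
  apply: le_measure; rewrite ?inE//.
  - by apply: measurableC; exact: grid_cover_measurable.
  - exact: bigcupT_measurable.
apply: (le_trans (measure_sigma_subadditive _ _ _ (@subset_refl _ _))) => //.
  exact: bigcupT_measurable.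
by rewrite eseries0// => n _ _; exact: F0.
Qed.

Definition tail_measure_term i := mscale (NngNum (ltW (grid_weight_gt0 i))) (grid_law i).

Definition tail_measure := mseries tail_measure_term 0.

HB.instance Definition _ := Measure.on tail_measure.

Let tail_measureE (A : set (measurableTypeR R)) z :
  (forall i, grid_law i A = (1 - grid_cantor i z)%:E) -> tail_measure A = (tail_sum z)%:E.
Proof.
move=> h; rewrite /tail_measure /mseries.
transitivity (\sum_(0 <= i <oo) (tail_term z i)%:E)%E.
  by apply: eq_eseriesr => i _; rewrite /tail_term EFinM -h.
rewrite (_ : (fun n => _) = EFin \o series (tail_term z)); last first.
  by apply/funext => n /=; rewrite /series/= sumEFin.
apply: cvg_lim => //; apply: cvg_EFin; last exact: cvg_tail_sum.
exact: nearW.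
Qed.

Lemma tail_measure_itv z : tail_measure `[z, +oo[ = (tail_sum z)%:E.
Proof.
apply: tail_measureE => i.
by apply: lebesgue_stieltjes_itvcy; exact: grid_cantor_continuous.
Qed.

Let tail_measure_finite : fin_num_fun tail_measure.
Proof.
apply: lty_fin_num_fun; rewrite [X in (X < _)%E](_ : _ = (tail_sum 0)%:E) ?ltry//.
apply: tail_measureE => i.
by rewrite (grid_cantor_eq0 (grid_left_ge0 i)) subr0; exact: probability_setT.
Qed.

HB.instance Definition _ := @Measure_isFinite.Build _ _ _ tail_measure tail_measure_finite.

Definition grid_set i : set R := \bigcap_k grid_cover i k.

Lemma grid_set_measurable i : measurable (grid_set i).
Proof. by apply: bigcapT_measurable => k; exact: grid_cover_measurable. Qed.

Lemma grid_set_null i : leb (grid_set i) = 0%E.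
Proof.
apply/eqP; rewrite eq_le measure_ge0 andbT; apply/lee_addgt0Pr => e e0.
have q : 0 <= (2 / 3 : R) < 1 by lra.
have [k /(_ k (leqnn k)) ke] := geometric_small (ler0n _ 3) q e0.
rewrite add0e; apply: (@le_trans _ _ (leb (grid_cover i k))).
  apply: le_measure; rewrite ?inE//; last exact: bigcap_inf.
    exact: grid_set_measurable.
  exact: grid_cover_measurable.
by apply: (le_trans (grid_cover_measure i k)); rewrite lee_fin.
Qed.

(** Off the union of all Cantor sets each [grid_law i] sees only a countable union of complements of
    its own covers, all of mass 0. This union is the carrier of [rho]. *)
Lemma tail_measure_grid_set :
  measurable (\bigcup_i grid_set i) /\ tail_measure (~` (\bigcup_i grid_set i)) = 0%E.
Proof.
have mE : measurable (\bigcup_i grid_set i).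
  by apply: bigcupT_measurable => i; exact: grid_set_measurable.
split => //; rewrite /tail_measure /mseries eseries0// => i _ _.
suff h : grid_law i (~` (\bigcup_j grid_set j)) = 0%E.
  by rewrite [LHS](congr1 (fun t => (grid_weight i)%:E * t)%E h) mule0.
apply/eqP; rewrite eq_le measure_ge0 andbT.
apply: (@le_trans _ _ (grid_law i (\bigcup_k ~` grid_cover i k))).
  apply: le_measure; rewrite ?inE//; first exact: measurableC.
    by apply: bigcupT_measurable => k; apply: measurableC; exact: grid_cover_measurable.
  by rewrite -setC_bigcap; apply: subsetC => x; exists i.
apply: (le_trans (measure_sigma_subadditive _ _ _ (@subset_refl _ _))) => //.
- by move=> k; apply: measurableC; exact: grid_cover_measurable.
- by apply: bigcupT_measurable => k; apply: measurableC; exact: grid_cover_measurable.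
- by rewrite eseries0// => k _ _; exact: grid_law_plateau.
Qed.

Lemma is_derive_little_o (f : R -> R) x :
  (forall e, 0 < e -> \forall y \near x, `|f y - f x| <= e * `|y - x|) ->
  is_derive x 1 f 0.
Proof.
move=> H.
have D : (fun h => h^-1 *: ((f \o shift x) (h *: 1) - f x)) @ 0^' --> (0 : R).
  apply/cvgrPdist_le => e e0; have := H e e0.
  rewrite near_withinE => /nbhs_ballP[d /= d0 hd].
  apply/nbhs_ballP; exists d => //= h; rewrite /ball/= sub0r normrN => hh h0.
  rewrite sub0r normrN normrM normfV ler_pdivrMl ?normr_gt0// mulrC.
  have := hd (h + x); rewrite /ball /= opprD addrCA subrr addr0 normrN => /(_ hh).
  by rewrite addrK /= [h *: 1]mulr1.
apply: DeriveDef; first by apply/cvg_ex; exists 0.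
exact: (cvg_lim (@Rhausdorff R) D).
Qed.

(** The two hypotheses handle different summands: avoiding the late diagonal covers gives the tail
    of the series small Lipschitz constants at [x], and avoiding every Cantor set makes any finite
    number of early summands locally constant. *)
Lemma tail_sum_derive_at x n :
  (forall i, (n <= i)%N -> ~ grid_cover i i x) -> (forall i, exists k, ~ grid_cover i k x) ->
  is_derive x (1 : R) tail_sum (0 : R).
Proof.
move=> hn hk.
have lc i : \forall y \near x, grid_cantor i y = grid_cantor i x.
  have [k nk] := hk i.
  have d0 : 0 < 3 ^- k * grid_len i.
    by rewrite mulr_gt0 ?grid_len_gt0//; case/andP: (exp3_itv k).
  near=> y; apply: grid_locally_cst nk _; rewrite distrC; near: y.
  exact: (@cvgr_dist_le _ _ _ _ _ id x).
apply: is_derive_little_o => e e0.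
(* The cut between early and late summands depends on [e]: from [m] on, the Lipschitz constants add
   up to at most [2 * 2 ^- m]. *)
have [m [nm me]] : exists m, (n <= m)%N /\ 2 * (2 : R) ^- m <= e.
  have half : 0 <= (2^-1 : R) < 1 by lra.
  have [k h] := geometric_small (ler0n _ 2) half e0.
  exists (maxn n k); split; first exact: leq_maxl.
  by have := h (maxn n k) (leq_maxr _ _); rewrite exprVn.
have lcm : \forall y \near x, forall i, (i < m)%N -> grid_cantor i y = grid_cantor i x.
  elim: m {nm me} => [|m IH]; first by move: (lc 0%N); apply: filterS => y _ i; rewrite ltn0.
  near=> y => i; rewrite ltnS leq_eqVlt => /orP[/eqP ->|].
    by near: y; exact: lc.
  by move: i; near: y; exact: IH.
near=> y; apply: (@le_trans _ _ (2 * 2 ^- m * `|y - x|)); last by rewrite ler_wpM2r.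
apply: tail_sum_lipschitz; first by near: y.
by move=> i mi; apply: hn; exact: leq_trans mi.
Unshelve. all: by end_near. Qed.

Lemma tail_sum_derive : {ae leb, forall x : R, is_derive x (1 : R) tail_sum (0 : R)}.
Proof.
(* The first set is null by Borel-Cantelli, the [i]-th diagonal cover having measure at most
   [3 * (2 / 3) ^+ i]; the second is a countable union of null Cantor sets. *)
pose N := lim_sup_set (fun i => grid_cover i i) `|` \bigcup_i grid_set i.
have N0 : leb.-negligible N.
  apply: negligibleU.
    apply/negligibleP.
      apply: bigcapT_measurable => k; apply: bigcup_measurable => j _.
      exact: grid_cover_measurable.
    apply: lim_sup_set_cvg0 => [k|]; first exact: grid_cover_measurable.
    have h2 : `|2 / 3 : R| < 1 by rewrite ger0_norm; lra.
    apply: (@le_lt_trans _ _ (\sum_(0 <= n <oo) (3 * (2 / 3) ^+ n)%:E)%E).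
      by apply: lee_nneseries => // n _; exact: grid_cover_measure.
    rewrite (_ : (fun n => _) = EFin \o series (geometric 3 (2 / 3))); last first.
      by apply/funext => n /=; rewrite /series/= sumEFin.
    have := @cvg_geometric_series R 3 (2 / 3) h2 => hc.
    have hE : (EFin \o series (geometric 3 (2 / 3))) k @[k --> \oo] --> (3 / (1 - 2 / 3) : R)%:E.
      by apply: cvg_EFin hc; exact: nearW.
    by rewrite (cvg_lim _ hE)// ltry.
  by apply: negligible_bigcup => i; apply/negligibleP; [exact: grid_set_measurable|exact: grid_set_null].
move: N0; apply: negligibleS => x /= nd; apply: contrapT => nN; apply: nd.
have [n hn] : exists n, forall i, (n <= i)%N -> ~ grid_cover i i x.
  apply: contrapT => h; apply: nN; left => n _; apply: contrapT => h'.
  by apply: h; exists n => i ni gi; apply: h'; exists i.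
apply: (tail_sum_derive_at hn) => i; apply: contrapT => h; apply: nN; right; exists i => // k _.
by apply: contrapT => h'; apply: h; exists k.
Qed.

End SingularTail.

(** * Iterated tail integrals *)

Section TailIntegral.
Variable R : realType.
Implicit Types (f : R -> R) (a s x y z : R).
Notation leb := (@lebesgue_measure R).

Lemma is_derive_continuous f x l : is_derive x 1 f l -> {for x, continuous f}.
Proof.
by move=> [df _]; apply: differentiable_continuous; exact/derivable1_diffP.
Qed.

(** A class stable under [tail_integral] with the same constant [A], since [A * expR (- x)] is its
    own tail integral. Asking for the bound on the whole line makes the derivatives two-sided at 0
    as well. *)
Definition exp_dominated f :=
  continuous f /\ exists A, forall x, 0 <= f x <= A * expR (- x).

Lemma exp_dominated_cvgy f : exp_dominated f -> f x @[x --> +oo] --> 0.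
Proof.
move=> [_ [A fA]].
apply: (@squeeze_cvgr _ _ _ _ (cst 0) (fun x => A * expR (- x))).
- by apply: nearW => x; exact: fA.
- exact: cvg_cst.
- rewrite -[X in _ --> X](mulr0 A); apply: cvgMr.
  exact: cvgr_expR.
Qed.

Lemma is_derive_expN A x : is_derive x 1 (fun t => - (A * expR (- t))) (A * expR (- x)).
Proof.
have h : is_derive x (1 : R) (fun t : R => - t) (-1) by exact: is_deriveN.
have h2 := @is_derive1_comp R expR (fun t => - t) x _ _ (is_derive_expR _) h.
rewrite (_ : A * expR (- x) = - (A *: (expR (- x) * -1))).
  exact: is_deriveN (is_deriveZ A h2).
by rewrite [_ *: _]/GRing.scale /= mulrN1 mulrN opprK.
Qed.

Lemma integral_expN A a : 0 <= A ->
  (\int[leb]_(x in `[a, +oo[) (A * expR (- x))%:E = (A * expR (- a))%:E)%E.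
Proof.
move=> A0.
rewrite (@ge0_continuous_FTC2y R (fun x => A * expR (- x)) (fun x => - (A * expR (- x))) a 0).
- by rewrite sub0e -EFinN opprK.
- by move=> x _; rewrite mulr_ge0// expR_ge0.
- apply: continuous_subspaceT => x; apply: cvgMr.
  apply: (@continuous_comp _ _ _ (fun t : R => - t) expR); first by apply: cvgN; exact: cvg_id.
  exact: continuous_expR.
- rewrite -oppr0 -[X in - X](mulr0 A); apply: cvgN; apply: cvgMr; exact: cvgr_expR.
- by move=> x _; have [] := is_derive_expN A x.
- by apply: cvg_at_right_filter; exact: (is_derive_continuous (is_derive_expN A a)).
- by move=> x _; rewrite derive1E; have [_ ->] := is_derive_expN A x.
Qed.

Definition tail_integral f s : R := fine (\int[leb]_(x in `[s, +oo[) (f x)%:E)%E.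

Section fixed.
Variable f : R -> R.
Hypothesis fd : exp_dominated f.

Lemma tail_integral_le A s : (forall x, 0 <= f x <= A * expR (- x)) ->
  (\int[leb]_(x in `[s, +oo[) (f x)%:E <= (A * expR (- s))%:E)%E.
Proof.
move=> fA.
have A0 : 0 <= A.
  by have /andP[h1 h2] := fA 0; have := le_trans h1 h2; rewrite oppr0 expR0 mulr1.
rewrite -integral_expN//; apply: ge0_le_integral => //=.
- by move=> x _; rewrite lee_fin; case/andP: (fA x).
- apply/measurable_EFinP; apply: measurable_funTS.
  by apply: continuous_measurable_fun; case: fd.
- apply/measurable_EFinP; apply: measurable_funTS; apply: continuous_measurable_fun => x.
  apply: cvgMr; apply: (@continuous_comp _ _ _ (fun t : R => - t) expR).
    by apply: cvgN; exact: cvg_id.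
  exact: continuous_expR.
- by move=> x _; rewrite lee_fin; case/andP: (fA x).
Qed.

Lemma tail_integralE s : (\int[leb]_(x in `[s, +oo[) (f x)%:E = (tail_integral f s)%:E)%E.
Proof.
case: fd => _ [A fA]; rewrite /tail_integral fineK// ge0_fin_numE.
  by apply: le_lt_trans (tail_integral_le s fA) _; rewrite ltry.
by apply: integral_ge0 => x _; rewrite lee_fin; case/andP: (fA x).
Qed.

Lemma tail_integral_bounds A s : (forall x, 0 <= f x <= A * expR (- x)) ->
  0 <= tail_integral f s <= A * expR (- s).
Proof.
move=> fA; rewrite -!lee_fin -tail_integralE tail_integral_le// andbT.
by apply: integral_ge0 => x _; rewrite lee_fin; case/andP: (fA x).
Qed.

Lemma tail_integral_derive s : is_derive s 1 (tail_integral f) (- f s).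
Proof.
case: (fd) => cf [A fA].
(* Reflection turns the tail integral into an integral from minus infinity with a variable upper
   end, to which the fundamental theorem of calculus applies. *)
pose g x := f (- x); pose H y := \int[leb]_(t in [set` Interval -oo%O (BRight y)]) g t.
have cg : continuous g.
  move=> x; apply: (@continuous_comp _ _ _ (fun t : R => - t) f); last exact: cf.
  by apply: cvgN; exact: cvg_id.
have gE y : (\int[leb]_(t in `]-oo, y]) (g t)%:E)%E = (tail_integral f (- y))%:E.
  rewrite -[y in LHS]opprK ge0_integration_by_substitutionNy.
  - rewrite -tail_integralE; apply: eq_integral => x _.
    by rewrite /g /= opprK.
  - exact: continuous_subspaceT.
  - by move=> x _; case/andP: (fA (- x)).
have HE : H = tail_integral f \o -%R.
  by apply/funext => y; rewrite /H /Rintegral gE.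
have ig : leb.-integrable `]-oo, (- s + 1)] (EFin \o g).
  apply/integrableP; split.
    by apply/measurable_EFinP; apply: measurable_funTS; exact: continuous_measurable_fun.
  rewrite (_ : (\int[leb]_(x in _) _)%E = (tail_integral f (- (- s + 1)))%:E) ?ltry//.
  rewrite -gE; apply: eq_integral => x _ /=; rewrite ger0_norm//.
  by case/andP: (fA (- x)).
have ss : - s < - s + 1 by rewrite ltrDl.
have [dH HE'] := @continuous_FTC1 R g -oo%O (- s) (- s + 1) ss ig (ltNyr _) (cg _).
have h1 : is_derive (- s) 1 H (g (- s)).
  by apply: DeriveDef => //; rewrite -derive1E.
have h2 : is_derive s (1 : R) (fun t : R => - t) (-1) by exact: is_deriveN.
have := @is_derive1_comp R H (fun t => - t) s _ _ h1 h2.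
rewrite (_ : H \o _ = tail_integral f); last first.
  by apply/funext => y; rewrite HE /= opprK.
by rewrite /g opprK mulrN1.
Qed.

Lemma tail_integral_exp_dominated : exp_dominated (tail_integral f).
Proof.
split.
  by move=> x; exact: (is_derive_continuous (tail_integral_derive x)).
case: fd => cf [A fA]; exists A => x; exact: tail_integral_bounds.
Qed.

End fixed.

Definition iter_tail k f := iter k tail_integral f.

Lemma iter_tail_exp_dominated k f : exp_dominated f -> exp_dominated (iter_tail k f).
Proof. by move=> fd; elim: k => //= k IH; exact: tail_integral_exp_dominated. Qed.

Lemma integral_shift_tail f a z : exp_dominated f ->
  (\int[leb]_(t in `[z, +oo[) (f (a + t))%:E)%E = (tail_integral f (a + z))%:E.
Proof.
move=> fd; have fd' := tail_integral_exp_dominated fd.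
case: (fd) => cf [A fA]; case: (fd') => cF _.
have sh x : is_derive x (1 : R) (fun t => a + t) 1.
  by have := is_deriveD (is_derive_cst a x 1) (is_derive_id x 1); rewrite add0r.
have dF x : is_derive x (1 : R) (fun t => - tail_integral f (a + t)) (f (a + x)).
  have := is_deriveN (@is_derive1_comp R (tail_integral f) (fun t => a + t) x _ _
    (tail_integral_derive fd _) (sh x)).
  by rewrite mulr1 opprK.
rewrite (@ge0_continuous_FTC2y R (fun t => f (a + t)) (fun t => - tail_integral f (a + t)) z 0).
- by rewrite sub0e -EFinN opprK.
- by move=> x _; case/andP: (fA (a + x)).
- apply: continuous_subspaceT => x; apply: (@continuous_comp _ _ _ (fun t => a + t) f).
    by apply: cvgD; [exact: cvg_cst|exact: cvg_id].
  exact: cf.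
- rewrite -oppr0; apply: cvgN; apply: cvg_comp (exp_dominated_cvgy fd').
  exact: cvg_addrl.
- by move=> x _; have [] := dF x.
- by apply: cvg_at_right_filter; exact: (is_derive_continuous (dF z)).
- by move=> x _; rewrite derive1E; have [_ ->] := dF x.
Qed.

End TailIntegral.

(** * Lebesgue measure on the product space *)

Lemma pushforward_semi_sigma_additive d1 d2 (T1 : measurableType d1) (T2 : measurableType d2)
    (R : realType) (mu : {measure set T1 -> \bar R}) (f : T1 -> T2) :
  measurable_fun setT f -> semi_sigma_additive (pushforward mu f).
Proof.
move=> mf F mF tF mUF; rewrite /pushforward preimage_bigcup.
have mS A : measurable A -> measurable (f @^-1` A).
  by move=> mA; rewrite -[X in measurable X]setTI; exact: mf.
apply: measure_semi_sigma_additive.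
- by move=> k; exact: mS.
- apply/trivIsetP => /= i j _ _ ij; rewrite -preimage_setI.
  by move/trivIsetP : tF => /(_ _ _ _ _ ij) ->//; rewrite preimage_set0.
- by rewrite -preimage_bigcup; exact: mS.
Qed.

Section Rn.
Variable R : realType.
Notation leb := (@lebesgue_measure R).

Lemma measurable_coord n (i : 'I_n) : measurable_fun setT (fun u : Rn R n => u i).
Proof.
move=> _ A mA; rewrite setTI; apply: sub_sigma_algebra.
by exists i, A.
Qed.

Lemma measurable_fun_Rn d (T : measurableType d) n (D : set T) (f : T -> Rn R n) :
  (forall i, measurable_fun D (fun x => f x i)) -> measurable_fun D f.
Proof.
move=> mf mD; move: (mD); apply: (@measurability _ _ T (Rn R n) D f (coord_gen R n)) => //.
by move=> _ [_ [i [A [mA ->]]] <-]; exact: mf.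
Qed.

Definition snoc n (p : Rn R n * measurableTypeR R) : Rn R n.+1 :=
  fun i => if insub (val i) is Some j then p.1 j else p.2.

Lemma snoc_widen n p (h : (n <= n.+1)%N) (i : 'I_n) : snoc p (widen_ord h i) = p.1 i.
Proof.
rewrite /snoc /= insubT// => lt.
by congr (p.1 _); exact: val_inj.
Qed.

Lemma snoc_max n (p : Rn R n * measurableTypeR R) : snoc p ord_max = p.2.
Proof. by rewrite /snoc insubF//= ltnn. Qed.

Lemma init_snoc n (p : Rn R n * measurableTypeR R) : init (snoc p) = p.1.
Proof. by apply/funext => i; rewrite /init snoc_widen. Qed.

Lemma ord_recrP n (P : 'I_n.+1 -> Prop) (h : (n <= n.+1)%N) :
  (forall i, P i) <-> (forall i, P (widen_ord h i)) /\ P ord_max.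
Proof.
split=> [H|[H Hm] i]; first by split.
have [e|ne] := eqVneq i ord_max; first by rewrite e.
have lt : (i < n)%N.
  have := ltn_ord i; rewrite ltnS leq_eqVlt => /orP[/eqP e|//].
  by case/negP : ne; apply/eqP/val_inj.
by rewrite (_ : i = widen_ord h (Ordinal lt))//; exact: val_inj.
Qed.

Lemma snocP n (p : Rn R n * measurableTypeR R) (P : 'I_n.+1 -> R -> Prop)
    (h : (n <= n.+1)%N) :
  (forall i, P i (snoc p i)) <->
  (forall i, P (widen_ord h i) (p.1 i)) /\ P ord_max p.2.
Proof.
rewrite (ord_recrP (fun i => P i (snoc p i)) h) snoc_max.
by split => -[H Hm]; split => // i; move: (H i); rewrite snoc_widen.
Qed.

Lemma measurable_snoc n : measurable_fun setT (@snoc n).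
Proof.
apply: measurable_fun_Rn; apply/(ord_recrP _ (leqnSn n)); split => [i|].
- rewrite (_ : (fun _ => _) = (fun u : Rn R n => u i) \o fst); last first.
    by apply/funext => p; rewrite snoc_widen.
  by apply: measurableT_comp => //; exact: measurable_coord.
- rewrite (_ : (fun _ => _) = snd)//.
  by apply/funext => p; rewrite snoc_max.
Qed.

Lemma measurable_init n : measurable_fun setT (@init R n).
Proof. by apply: measurable_fun_Rn => i; exact: measurable_coord. Qed.

Lemma measurable_lastc n : measurable_fun setT (@lastc R n).
Proof. by case: n => [|n]; [exact: measurable_cst|exact: measurable_coord]. Qed.

Section lebn.
Variables (n : nat) (m : {sigma_finite_measure set (Rn R n) -> \bar R}).

Definition lebn_step : set (Rn R n.+1) -> \bar R := pushforward (m \x leb)%E (@snoc n).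

Let lebn_step0 : lebn_step set0 = 0%E.
Proof. by rewrite /lebn_step /pushforward preimage_set0 measure0. Qed.

Let lebn_step_ge0 A : (0 <= lebn_step A)%E.
Proof. by rewrite /lebn_step /pushforward; exact: measure_ge0. Qed.

Let lebn_step_sigma_additive : semi_sigma_additive lebn_step.
Proof. by apply: pushforward_semi_sigma_additive; exact: measurable_snoc. Qed.

HB.instance Definition _ := isMeasure.Build _ _ _
  lebn_step lebn_step0 lebn_step_ge0 lebn_step_sigma_additive.

Let lebn_step_sigma_finite : sigma_finite setT lebn_step.
Proof.
have /sigma_finiteP[F [FT ndF hF]] := sigma_finiteT m.
pose B k : set (measurableTypeR R) := `[- k%:R, k%:R]%classic.
have mB k : measurable (B k) by exact: measurable_itv.
pose C k : set (Rn R n.+1) := @init R n.+1 @^-1` F k `&` @lastc R n.+1 @^-1` B k.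
exists C.
  apply/seteqP; split => // u _.
  have [k _ hk] : (\bigcup_k F k) (init u) by rewrite -FT.
  (* Both exhausting sequences increase, so the larger of the two indices serves both factors. *)
  pose j := (Num.truncn `|lastc u|).+1; exists (maxn k j) => //; split.
    have hS : F k `<=` F (maxn k j) by exact/subsetPset/ndF/leq_maxl.
    exact: hS.
  have h : `|lastc u| <= (maxn k j)%:R.
    by apply: (@le_trans _ _ j%:R); rewrite ?ler_nat ?leq_maxr// ltW// truncnS_gt.
  by rewrite /B /= in_itv/= -ler_norml.
move=> k; have [mF Foo] := hF k; split.
  apply: measurableI; rewrite -[X in measurable X]setTI.
    exact: (@measurable_init n.+1 measurableT _ mF).
  exact: (@measurable_lastc n.+1 measurableT _ (mB k)).
rewrite /lebn_step /pushforward.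
have -> : @snoc n @^-1` C k = F k `*` B k.
  by apply/seteqP; split => p; rewrite /C /= init_snoc snoc_max.
rewrite product_measure1E// lte_mul_pinfty// ?ge0_fin_numE//.
suff : (leb (B k) < +oo)%E by exact.
by rewrite /B lebesgue_measure_itv /=; case: ifP => _; rewrite ?ltry.
Qed.

HB.instance Definition _ := @Measure_isSigmaFinite.Build _ _ _
  lebn_step lebn_step_sigma_finite.

End lebn.

Definition Rn_origin n : Rn R n := fun=> 0.

(** Lebesgue measure by iterated products, starting from the unit mass on the one-point space.
    Sigma-finiteness is carried in the type because the next product and Tonelli's theorem require
    it. *)
Fixpoint lebn n : {sigma_finite_measure set (Rn R n) -> \bar R} :=
  match n return {sigma_finite_measure set (Rn R n) -> \bar R} with
  | 0%N => @dirac _ (Rn R 0) (@Rn_origin 0) R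
  | k.+1 => lebn_step (lebn k)
  end.

Lemma lebn0E A : lebn 0 A = @dirac _ (Rn R 0) (@Rn_origin 0) R A.
Proof. by []. Qed.

Lemma lebnSE n A : lebn n.+1 A = (lebn n \x leb)%E (@snoc n @^-1` A).
Proof. by []. Qed.

Lemma measurable_Rn_rect n (A : 'I_n -> set R) : (forall i, measurable (A i)) ->
  measurable [set x : Rn R n | forall i, A i (x i)].
Proof.
move=> mA.
rewrite (_ : mkset _ = \bigcap_(i in [set: 'I_n]) ((fun x : Rn R n => x i) @^-1` A i)).
  apply: fin_bigcap_measurable => // i _.
  rewrite -[X in measurable X]setTI; exact: (@measurable_coord n i measurableT _ (mA i)).
by apply/seteqP; split => x /= h i; [move=> _|]; exact: h.
Qed.

Lemma lebn_rect n (A : 'I_n.+1 -> set R) (h : (n <= n.+1)%N) : (forall i, measurable (A i)) ->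
  (lebn n.+1 [set x | forall i, A i (x i)] =
   lebn n [set x | forall i, A (widen_ord h i) (x i)] * leb (A ord_max))%E.
Proof.
move=> mA; rewrite lebnSE.
rewrite (_ : _ @^-1` _ = [set x : Rn R n | forall i, A (widen_ord h i) (x i)] `*` A ord_max).
  rewrite product_measure1E//; last exact: mA.
  exact: (@measurable_Rn_rect n (fun i => A (widen_ord h i)) (fun i => mA _)).
by apply/seteqP; split => p /=; rewrite (snocP p (fun i => A i) h).
Qed.

Lemma lebn_open_box_gt0 n (a b : 'I_n -> R) : (forall i, a i < b i) ->
  (0 < lebn n [set x : Rn R n | forall i, `]a i, b i[%classic (x i)])%E.
Proof.
elim: n a b => [|n IH] a b ab.
  rewrite (_ : mkset _ = setT); last by apply/seteqP; split => // x _ [].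
  by rewrite lebn0E diracT.
rewrite (lebn_rect (A := fun i => `]a i, b i[%classic) (leqnSn n)) ?mule_gt0 ?IH//.
by rewrite lebesgue_measure_itv /= lte_fin ab -EFinB lte_fin subr_gt0.
Qed.

Lemma measurable_sum_coord n : measurable_fun setT (fun x : Rn R n => \sum_i x i).
Proof. by apply: measurable_sum => i; exact: measurable_coord. Qed.

Lemma sum_snoc n (p : Rn R n * measurableTypeR R) :
  \sum_i snoc p i = \sum_i p.1 i + p.2.
Proof.
rewrite big_ord_recr /= snoc_max; congr (_ + _).
by apply: eq_bigr => i _; rewrite snoc_widen.
Qed.

(* Iterated integration over an orthant with corner [z]: each coordinate turns
   the integrand, a function of the coordinate sum, into its tail integral. *)
Lemma integral_orthant n (f : R -> R) (z : 'I_n -> R) s : exp_dominated f ->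
  (\int[lebn n]_(x in [set x : Rn R n | forall i, `[z i, +oo[%classic (x i)])
    (f (s + \sum_i x i)%R)%:E = (iter_tail n f (s + \sum_i z i)%R)%:E)%E.
Proof.
have mfs k (h : R -> R) (t : R) : exp_dominated h ->
    measurable_fun setT (fun x : Rn R k => (h (t + \sum_i x i))%:E).
  move=> [ch _]; apply/measurable_EFinP; apply: measurableT_comp.
    exact: continuous_measurable_fun.
  by apply: measurable_funD => //; exact: measurable_sum_coord.
elim: n f z s => [|n IH] f z s fd.
  rewrite (_ : mkset _ = setT); last by apply/seteqP; split => // x _ [].
  rewrite [LHS]integral_dirac ?diracT ?mul1e ?big_ord0//; exact: mfs.
have [cf [A fA]] := fd.
have f0 x : (0 <= (f x)%:E)%E by rewrite lee_fin; case/andP: (fA x).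
set Z := [set x : Rn R n.+1 | forall i, `[z i, +oo[%classic (x i)].
have mZ : measurable Z.
  exact: (@measurable_Rn_rect n.+1 (fun i => `[z i, +oo[%classic) (fun i => measurable_itv _)).
rewrite integral_mkcond.
have mg : measurable_fun setT ((fun x : Rn R n.+1 => (f (s + \sum_i x i))%:E) \_ Z).
  by apply/(measurable_restrictT _ mZ); apply: measurable_funTS; exact: mfs.
have g0 x : (0 <= ((fun x : Rn R n.+1 => (f (s + \sum_i x i))%:E) \_ Z) x)%E.
  by apply: erestrict_ge0.
rewrite [LHS](ge0_integral_pushforward (@measurable_snoc n)) ?preimage_setT//.
rewrite [LHS]fubini_tonelli1; last 2 first.
- exact: (measurableT_comp mg (@measurable_snoc n)).
- by move=> p; exact: g0.
pose z' i := z (widen_ord (leqnSn n) i).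
transitivity (\int[lebn n]_(x in [set x : Rn R n | forall i, `[z' i, +oo[%classic (x i)])
    (tail_integral f (s + z ord_max + \sum_i x i)%R)%:E)%E; last first.
  rewrite IH; last exact: tail_integral_exp_dominated.
  by rewrite /iter_tail iterSr big_ord_recr/= -addrA [z _ + _]addrC.
rewrite [RHS]integral_mkcond; apply: eq_integral => x _.
rewrite /fubini_F /= patchE.
have eZ t : Z (snoc (x, t)) = ((forall i, `[z' i, +oo[%classic (x i)) /\ `[z ord_max, +oo[%classic t).
  by apply/propext; rewrite /Z /= (snocP (x, t) (fun i => `[z i, +oo[%classic) (leqnSn n)).
case: ifPn => [/set_mem /= hx|/negP hx].
  rewrite (_ : s + z ord_max + _ = s + \sum_i x i + z ord_max); last by rewrite addrAC.
  rewrite -integral_shift_tail// [RHS]integral_mkcond; apply: eq_integral => t _.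
  rewrite !patchE /= sum_snoc addrA.
  by congr (if _ then _ else _); apply/idP/idP => /set_mem; [rewrite eZ => -[_ ?]|move=> ?];
    apply/mem_set => //; rewrite eZ.
rewrite integral0_eq// => t _; rewrite patchE; case: ifPn => // /set_mem.
by rewrite eZ => -[h _]; case: hx; exact/mem_set.
Qed.

End Rn.

(** * Positivity, convexity and higher derivatives of iterated tail integrals *)

Section TailPositivity.
Variable R : realType.
Implicit Types (f : R -> R) (x y z t : R).

Lemma MVT_tail f x y : exp_dominated f -> x <= y ->
  exists2 w, x <= w <= y & tail_integral f x - tail_integral f y = f w * (y - x).
Proof.
move=> fd xy.
have [|w] := @MVT_segment R (tail_integral f) (fun t => - f t) x y xy
  (fun t _ => tail_integral_derive fd t).
  by apply: continuous_subspaceT => t; exact: (is_derive_continuous (tail_integral_derive fd t)).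
by rewrite in_itv/= => h e; exists w => //; rewrite -opprB e mulNr opprK.
Qed.

Lemma tail_integral_decr f x y : exp_dominated f -> (forall z, 0 < f z) -> x < y ->
  tail_integral f y < tail_integral f x.
Proof.
move=> fd f0 xy; have [w _ e] := MVT_tail fd (ltW xy).
by rewrite -subr_gt0 e mulr_gt0// subr_gt0.
Qed.

Lemma tail_integral_gt0 f x : exp_dominated f -> (forall z, 0 < f z) -> 0 < tail_integral f x.
Proof.
move=> fd f0; have xx : x < x + 1 by rewrite ltrDl.
apply: le_lt_trans (tail_integral_decr fd f0 xx).
by case: (tail_integral_exp_dominated fd) => _ [A fA]; case/andP: (fA (x + 1)).
Qed.

Lemma iter_tail_gt0 k f x : exp_dominated f -> (forall z, 0 < f z) -> 0 < iter_tail k f x.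
Proof.
move=> fd f0; elim: k x => //= k IH x; apply: tail_integral_gt0 => //.
exact: iter_tail_exp_dominated.
Qed.

Lemma iter_tail_nonincr k f x y : exp_dominated f -> (forall z, 0 < f z) ->
  (forall x y, x <= y -> f y <= f x) -> x <= y -> iter_tail k f y <= iter_tail k f x.
Proof.
move=> fd f0 fn xy; case: k => [|k]; first exact: fn.
move: xy; rewrite le_eqVlt => /orP[/eqP->//|xy].
apply: ltW; apply: tail_integral_decr => //; first exact: iter_tail_exp_dominated.
by move=> z; exact: iter_tail_gt0.
Qed.

(* The derivative [- f] of [tail_integral f] is nondecreasing. *)
Lemma tail_integral_convex f x y t : exp_dominated f ->
  (forall x y, x <= y -> f y <= f x) -> 0 <= t <= 1 ->
  tail_integral f (t * x + (1 - t) * y) <= t * tail_integral f x + (1 - t) * tail_integral f y.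
Proof.
move=> fd fn; wlog xy : x y t / x <= y.
  move=> h t01; have [xy|/ltW yx] := leP x y; first exact: h.
  have t01' : 0 <= 1 - t <= 1 by case/andP: t01 => t0 t1; rewrite subr_ge0 t1 gerBl t0.
  by have := h y x (1 - t) yx t01'; rewrite subKr addrC [X in _ <= X]addrC.
move=> /andP[t0 t1]; set w := t * x + _.
have xw : x <= w.
  by rewrite -subr_ge0 (_ : w - x = (1 - t) * (y - x)) ?mulr_ge0 ?subr_ge0// /w; ring.
have wy : w <= y.
  by rewrite -subr_ge0 (_ : y - w = t * (y - x)) ?mulr_ge0 ?subr_ge0// /w; ring.
have [a /andP[_ aw] ha] := MVT_tail fd xw.
have [b /andP[wb _] hb] := MVT_tail fd wy.
have fab := fn _ _ (le_trans aw wb).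
have hx : tail_integral f x = tail_integral f w + f a * ((1 - t) * (y - x)).
  by rewrite (_ : (1 - t) * (y - x) = w - x) -?ha ?/w; ring.
have hy : tail_integral f y = tail_integral f w - f b * (t * (y - x)).
  by rewrite (_ : t * (y - x) = y - w) -?hb ?/w; ring.
rewrite hx hy -subr_ge0.
set T := tail_integral f w.
rewrite (_ : _ - T = t * (1 - t) * (y - x) * (f a - f b)); last by ring.
by rewrite !mulr_ge0 ?subr_ge0.
Qed.

(** The inner factor [c] anticipates the rescaling that enforces [psi 1 = 1/2]. *)
Lemma derive1n_tail f k c j : exp_dominated f -> (j <= k)%N ->
  derive1n j (fun z => iter_tail k f (c * z)) =
  (fun z => (- c) ^+ j * iter_tail (k - j) f (c * z)).
Proof.
move=> fd; elim: j => [|j IH] jk.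
  by apply/funext => z; rewrite derive1n0 expr0 mul1r subn0.
rewrite derive1nS IH ?(ltnW jk)//; apply/funext => z.
have -> : (k - j = (k - j.+1).+1)%N by rewrite subnSK.
have dF := tail_integral_derive (iter_tail_exp_dominated (k - j.+1) fd) (c * z).
have dc : is_derive z (1 : R) (fun t => c * t) c.
  by have := is_deriveZ c (is_derive_id z (1 : R)); rewrite [_ *: _]mulr1.
have := is_deriveZ ((- c) ^+ j) (@is_derive1_comp R _ _ z _ _ dF dc).
move=> h; rewrite derive1E; have [_ ->] := h.
rewrite [_ *: _]/GRing.scale /= exprS; ring.
Qed.

Lemma derivable_tail f k c j z : exp_dominated f -> (j < k)%N ->
  derivable (derive1n j (fun z => iter_tail k f (c * z))) z 1.
Proof.
move=> fd jk; rewrite derive1n_tail// ?(ltnW jk)//.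
have -> : (k - j = (k - j.+1).+1)%N by rewrite subnSK.
have dF := tail_integral_derive (iter_tail_exp_dominated (k - j.+1) fd) (c * z).
have dc : is_derive z (1 : R) (fun t => c * t) c.
  by have := is_deriveZ c (is_derive_id z (1 : R)); rewrite [_ *: _]mulr1.
by have [] := is_deriveZ ((- c) ^+ j) (@is_derive1_comp R _ _ z _ _ dF dc).
Qed.

End TailPositivity.

(** * Null sets and distribution functions *)

Lemma null_interval_cover (R : realType) (N : set R) e : 0 < e ->
  (@lebesgue_measure R) N = 0%E ->
  exists a b : nat -> R, [/\ forall k, a k <= b k, N `<=` \bigcup_k `]a k, b k]%classic &
    (\sum_(0 <= k <oo) (b k - a k)%:E <= e%:E)%E].
Proof.
move=> e0 N0.
have fN : (@lebesgue_measure R) N \is a fin_num by rewrite N0.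
have [_ [F [mF NF] <-]] := lb_ereal_inf_adherent e0 fN.
rewrite [X in (_ < X + _)%E -> _](_ : _ = (@lebesgue_measure R) N)// N0 add0e => hF.
have /choice[x hx] : forall k, exists x : R * R, F k = `]x.1, x.2]%classic.
  by move=> k; have [x _ <-] := mF k; exists x.
(* An interval of the cover may be given with its ends reversed, and is then empty; the maximum
   orders the ends and leaves the length unchanged. *)
exists (fun k => (x k).1), (fun k => Num.max (x k).1 (x k).2); split.
- by move=> k; rewrite le_max lexx.
- apply: (subset_trans NF) => t [k _]; rewrite hx /= in_itv/= => /andP[h1 h2].
  by exists k => //=; rewrite in_itv/= h1 le_max h2 orbT.
- apply: le_trans (ltW hF); rewrite le_eqVlt; apply/orP; left; apply/eqP.
  apply: eq_eseriesr => k _; rewrite hx.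
  suff : wlength idfun `](x k).1, (x k).2]%classic =
    (Num.max (x k).1 (x k).2 - (x k).1)%:E by exact.
  have [h|h] := leP (x k).1 (x k).2; first by rewrite wlength_itv_bnd.
  by rewrite set_itv_ge ?wlength0 ?subrr// bnd_simp -leNgt ltW.
Qed.

Section Distribution.
Context d (T : measurableType d) (R : realType) (P : probability T R) (X : T -> R).
Hypothesis mX : measurable_fun setT X.

Let mle t : measurable [set w | X w <= t].
Proof.
rewrite (_ : mkset _ = X @^-1` `]-oo, t]%classic).
  by rewrite -[Y in measurable Y]setTI; apply: mX => //; exact: measurable_itv.
by apply/seteqP; split => w; rewrite /= in_itv.
Qed.

Let moc s t : measurable [set w | s < X w <= t].
Proof.
rewrite (_ : mkset _ = X @^-1` `]s, t]%classic).
  by rewrite -[Y in measurable Y]setTI; apply: mX => //; exact: measurable_itv.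
by apply/seteqP; split => w; rewrite /= in_itv.
Qed.

Lemma distribution_diff s t : s <= t ->
  fine (P [set w | X w <= t]) - fine (P [set w | X w <= s]) = fine (P [set w | s < X w <= t]).
Proof.
move=> st; have -> : [set w | X w <= t] = [set w | X w <= s] `|` [set w | s < X w <= t].
  apply/seteqP; split => w /=; last by move=> [/le_trans->//|/andP[]].
  by move=> ->; rewrite andbT; have [?|?] := leP (X w) s; [left|right].
rewrite measureU//; last first.
  by apply/seteqP; split => w //= -[h /andP[]]; rewrite ltNge h.
rewrite fineD ?fin_num_measure//; lra.
Qed.

(** The events [D n] decrease to [X = t], so their probabilities tend to 0; they bound the
    increments near [t] on both sides at once. *)
Lemma distribution_continuous : (forall t, P [set w | X w = t] = 0%E) ->
  continuous (fun t => fine (P [set w | X w <= t])).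
Proof.
move=> P0 t.
pose D n := [set w | t - n.+1%:R^-1 < X w <= t + n.+1%:R^-1].
have hD : P (D n) @[n --> \oo] --> 0%E.
  rewrite -(P0 t) (_ : [set w | X w = t] = \bigcap_n D n); last first.
    apply/seteqP; split => w /=.
      by move=> Xw n _; rewrite /D /= Xw ltrBlDr !ltrDl !lerDl !invr_ge0 invr_gt0 ltr0n ler0n.
    move=> h; apply/eqP; rewrite eq_le; apply/andP; split.
      apply/ler_addgt0Pr => e e0; have [n _ hn] := near_infty_natSinv_lt (PosNum e0).
      have /andP[_ h2] := h n I; apply: (le_trans h2); rewrite lerD2l; apply: ltW.
      exact: (hn n (leqnn n)).
    apply/ler_addgt0Pr => e e0; rewrite -lerBlDr; have [n _ hn] := near_infty_natSinv_lt (PosNum e0).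
    have /andP[h2 _] := h n I; apply: (le_trans _ (ltW h2)); rewrite lerD2l lerN2; apply: ltW.
    exact: (hn n (leqnn n)).
  apply: nonincreasing_cvg_mu => //.
  - by apply: (@le_lt_trans _ _ 1%E); [apply: probability_le1; exact: moc|exact: ltry].
  - by move=> n; exact: moc.
  - by apply: bigcapT_measurable => n; exact: moc.
  - apply/nonincreasing_seqP => n; apply/subsetPset => w /= /andP[h1 h2].
    have h : n.+2%:R^-1 <= n.+1%:R^-1 :> R by rewrite lef_pV2 ?posrE ?ltr0n// ler_nat.
    move: h h1 h2; rewrite /D /=; move: (n.+2%:R^-1) (n.+1%:R^-1) => p q h h1 h2.
    by apply/andP; split; lra.
apply/cvgrPdist_le => e e0.
have /fine_cvgP[_ /cvgrPdist_le/(_ _ e0)[n _ /(_ n (leqnn n))]] := hD.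
rewrite /= sub0r normrN ger0_norm ?fine_ge0// => hn.
have n0 : 0 < n.+1%:R^-1 :> R by rewrite invr_gt0 ltr0n.
have le_D s s' : s <= s' -> t - n.+1%:R^-1 <= s -> s' <= t + n.+1%:R^-1 ->
    0 <= fine (P [set w | X w <= s']) - fine (P [set w | X w <= s]) <= e.
  move=> ss' h1 h2; rewrite distribution_diff// fine_ge0//=.
  apply: le_trans hn; apply: fine_le; rewrite ?fin_num_measure//; first exact: moc.
  apply: le_measure; rewrite ?inE//; first exact: moc.
  move=> w /= /andP[h3 h4]; move: h1 h2; rewrite /D /=; move: (n.+1%:R^-1) => q h1 h2.
  by apply/andP; split; lra.
near=> s; have : `|t - s| <= n.+1%:R^-1.
  by near: s; exact: (@cvgr_dist_le _ _ _ _ _ id t).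
rewrite ler_norml; move: le_D; move: (n.+1%:R^-1) => q le_D hs; have [st|st] := leP s t.
  have := le_D s t st; rewrite ler_norml; lra.
have := le_D t s (ltW st); rewrite ler_norml; lra.
Unshelve. all: by end_near. Qed.

End Distribution.

(** * Covers by countably many boxes *)

Section LebesgueNull.
Variables (R : realType) (n : nat).
Implicit Types (A : set (Rn R n)) (a b : nat -> 'I_n -> R).

Definition box_vol (a b : 'I_n -> R) : R := \prod_(i < n) (b i - a i).

Definition box (a b : 'I_n -> R) : set (Rn R n) := [set v | forall i, a i <= v i <= b i].

Lemma box_vol_ge0 (a b : 'I_n -> R) : (forall i, a i <= b i) -> 0 <= box_vol a b.
Proof. by move=> ab; apply: prodr_ge0 => i _; rewrite subr_ge0. Qed.

(** Quantitative form of [leb_null]: a fixed bound [c] on the total volume can be summed over a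
    countable union. *)
Definition box_cover A (c : \bar R) := exists a b, [/\ (forall k i, a k i <= b k i),
  A `<=` \bigcup_k box (a k) (b k) & (\sum_(0 <= k <oo) (box_vol (a k) (b k))%:E <= c)%E].

Lemma box_cover_sub A B c : A `<=` B -> box_cover B c -> box_cover A c.
Proof. by move=> AB [a [b [ab Bab s]]]; exists a, b; split => //; exact: subset_trans Bab. Qed.

Lemma box_cover_bigcup (F : nat -> set (Rn R n)) (c : nat -> \bar R) :
  (forall k, box_cover (F k) (c k)) -> box_cover (\bigcup_k F k) (\sum_(0 <= k <oo) c k)%E.
Proof.
move=> /choice[a /choice[b h]].
have /card_esym/ppcard_eqP[f] := card_nat2.
exists (fun i => a (f i).1 (f i).2), (fun i => b (f i).1 (f i).2).
have v0 k j : (0 <= (box_vol (a k j) (b k j))%:E)%E.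
  by rewrite lee_fin box_vol_ge0//; case: (h k).
split.
- by move=> i; case: (h (f i).1).
- move=> x [k _ Fx]; have [_ /(_ _ Fx)[j _ hx] _] := h k.
  by have [i _ fi] := 'surj_f (I : setT (k, j)); exists i => //; rewrite fi.
- rewrite nneseries_esumT; last by move=> i; exact: v0.
  apply: (@le_trans _ _ (\sum_(0 <= k <oo) \sum_(0 <= j <oo) (box_vol (a k j) (b k j))%:E)%E); last first.
    by apply: lee_nneseries => [k _ _|k _]; [exact: nneseries_ge0|case: (h k)].
  rewrite nneseries_esumT; last by move=> k; exact: nneseries_ge0.
  rewrite (eq_esum (fun k _ => nneseries_esumT (v0 k))).
  rewrite (@esum_esum _ _ _ setT (fun=> setT))//.
  rewrite (reindex_esum [set: nat] _ f)//.
  rewrite (_ : _ `*`` _ = [set: nat * nat]); first exact: 'bij_f.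
  by apply/seteqP; split.
Qed.

Lemma box_cover_fin (I : finType) (a b : I -> 'I_n -> R) : (0 < n)%N ->
  (forall k i, a k i <= b k i) ->
  box_cover (\bigcup_(k in setT) box (a k) (b k)) (\sum_k box_vol (a k) (b k))%:E.
Proof.
move=> n0 ab.
(* The finite family is padded with boxes reduced to the origin. Their volume is 0 because [n] is
   positive; in dimension 0 the empty product would be 1. *)
pose ext (u : I -> 'I_n -> R) (j : nat) : 'I_n -> R :=
  if insub j is Some r then u (@enum_val I predT r) else (fun _ => 0).
exists (ext a), (ext b); split.
- by move=> j i; rewrite /ext; case: (insub _) => [r|]; rewrite ?lexx.
- move=> x [k _ hx]; exists (enum_rank k) => //.
  by rewrite /ext valK enum_rankK.
pose v j := box_vol (ext a j) (ext b j).
have v0 j : 0 <= v j.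
  by apply: box_vol_ge0 => i; rewrite /ext; case: (insub _) => [r|]; rewrite ?lexx.
have vN j : (#|I| <= j)%N -> v j = 0.
  move=> hj; rewrite /v /ext insubF; last by rewrite ltnNge hj.
  rewrite /box_vol; under eq_bigr do rewrite subrr.
  by rewrite prodr_const card_ord expr0n gtn_eqF.
apply: lime_le; first by apply: is_cvg_nneseries => j _ _; rewrite lee_fin v0.
near=> N; rewrite sumEFin lee_fin.
have hN : (#|I| <= N)%N by near: N; exact: nbhs_infty_ge.
rewrite (big_cat_nat (n := #|I|))//= [X in _ + X]big_nat_cond [X in _ + X]big1 ?addr0; last first.
  by move=> j /andP[/andP[hj _] _]; exact: vN.
rewrite big_mkord le_eqVlt; apply/orP; left; apply/eqP.
rewrite [RHS](reindex (@enum_val I predT)); last first.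
  by apply: onW_bij; exact: enum_val_bij.
by apply: eq_bigr => r _; rewrite /ext valK.
Unshelve. all: by end_near. Qed.

End LebesgueNull.

(** * The copula and its law *)

Section Generator.
Variables (R : realType) (G : R -> R) (m : nat).
Implicit Types (u v x y z s t : R).
Hypothesis Gd : exp_dominated G.
Hypothesis G0 : forall z, 0 < G z.
Hypothesis Gn : forall x y, x <= y -> G y <= G x.
Hypothesis Gnorm : iter_tail m.+1 G 0 = 1.

(** The generator before rescaling, in dimension [d = m.+2], hence with [d - 1 = m.+1] integrations.
    It is strictly decreasing on the whole line (and exceeds 1 on the negative side), so comparisons
    are equivalences without sign conditions. *)
Definition psi0 z := iter_tail m.+1 G z.

Let psi0_derive z : is_derive z 1 psi0 (- iter_tail m G z).
Proof. exact: (tail_integral_derive (iter_tail_exp_dominated m Gd)). Qed.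

Lemma psi0_0 : psi0 0 = 1. Proof. exact: Gnorm. Qed.

Lemma psi0_gt0 z : 0 < psi0 z.
Proof. exact: iter_tail_gt0. Qed.

Lemma psi0_decr x y : (psi0 y < psi0 x) = (x < y).
Proof.
have h a b : a < b -> psi0 b < psi0 a.
  move=> ab; apply: tail_integral_decr => //; first exact: iter_tail_exp_dominated.
  by move=> z; exact: iter_tail_gt0.
have [/h//|yx] := ltP x y.
apply/negbTE; rewrite -leNgt; move: yx; rewrite le_eqVlt => /orP[/eqP->//|/h/ltW//].
Qed.

Lemma psi0_nincr x y : (psi0 y <= psi0 x) = (x <= y).
Proof. by rewrite !leNgt psi0_decr. Qed.

Lemma psi0_continuous : continuous psi0.
Proof. by move=> z; exact: (is_derive_continuous (psi0_derive z)). Qed.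

Lemma psi0_cvgy : psi0 z @[z --> +oo] --> 0.
Proof. exact/exp_dominated_cvgy/iter_tail_exp_dominated. Qed.

Lemma psi0_le1 z : 0 <= z -> psi0 z <= 1.
Proof. by rewrite -psi0_0 psi0_nincr. Qed.

Lemma psi0_surj u : 0 < u <= 1 -> exists2 z, 0 <= z & psi0 z = u.
Proof.
move=> /andP[u0 u1].
have [y [y0 yu]] : exists y, 0 <= y /\ psi0 y <= u.
  have /cvgrPdist_lt /(_ _ u0) h := psi0_cvgy.
  have h2 : \forall y \near +oo, 0 <= y :> R by exact: nbhs_pinfty_ge.
  have [y [yu y0]] := filter_ex (filterI h h2); exists y; split => //.
  by move: yu => /=; rewrite sub0r normrN gtr0_norm ?psi0_gt0// => /ltW.
have [|z] := @IVT R psi0 0 y u y0 (continuous_subspaceT psi0_continuous).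
  by rewrite ge_min le_max yu psi0_0 u1 orbT.
by rewrite in_itv/= => /andP[z0 _] zu; exists z.
Qed.

(** A real-valued inverse on []0, 1]]. Its default 0 is the wrong value at 0, where the
    pseudo-inverse is infinite; hence [arch_cop] and [cond_df] test positivity first. Above 1 the
    default agrees with the value at 1. *)
Definition phi0 u := xget 0 [set z | 0 <= z /\ psi0 z = u].

Lemma psi0K z : 0 <= z -> phi0 (psi0 z) = z.
Proof.
move=> z0; rewrite /phi0; case: xgetP => [y _ [y0 e]|/(_ z)[]//].
by apply/eqP; rewrite eq_le -(psi0_nincr y z) -(psi0_nincr z y) e lexx.
Qed.

Lemma phi0_ge0 u : 0 <= phi0 u.
Proof. by rewrite /phi0; case: xgetP => [y _ []|]. Qed.

Lemma phi0K u : 0 < u <= 1 -> psi0 (phi0 u) = u.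
Proof. by move=> /psi0_surj[z z0 <-]; rewrite psi0K. Qed.

Lemma phi0_1 : phi0 1 = 0.
Proof. by rewrite -psi0_0 psi0K. Qed.

Lemma phi0_out u : u <= 0 \/ 1 < u -> phi0 u = 0.
Proof.
move=> h; rewrite /phi0; case: xgetP => // z _ [z0 zu]; case: h.
  by rewrite -zu leNgt psi0_gt0.
by rewrite -zu ltNge psi0_le1.
Qed.

Lemma le_psi0 u z : 0 < u <= 1 -> (psi0 z <= u) = (phi0 u <= z).
Proof. by move=> u01; rewrite -[X in _ <= X]phi0K// psi0_nincr. Qed.

Lemma lt_psi0 u z : 0 < u <= 1 -> (psi0 z < u) = (phi0 u < z).
Proof. by move=> u01; rewrite -[X in _ < X]phi0K// psi0_decr. Qed.

Lemma phi0_decr u v : 0 < u -> u < v -> v <= 1 -> phi0 v < phi0 u.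
Proof. by move=> u0 uv v1; rewrite -psi0_decr !phi0K//; lra. Qed.

Lemma measurable_phi0 : measurable_fun setT phi0.
Proof.
move=> _; apply: (@measurability _ _ _ _ _ _ (@RGenOInfty.G R)) => //.
  exact: RGenOInfty.measurableE.
move=> _ [_ [z ->] <-]; rewrite setTI.
have [z0|z0] := ltP z 0.
  rewrite (_ : _ @^-1` _ = setT)//; apply/seteqP; split => // u _.
  by rewrite /= in_itv/= andbT (lt_le_trans z0)// phi0_ge0.
rewrite (_ : _ @^-1` _ = `]0, psi0 z[%classic); first exact: measurable_itv.
apply/seteqP; split => u /=; rewrite !in_itv/= andbT.
  move=> zu; have u01 : 0 < u <= 1.
    rewrite ltNge [X in _ && X]leNgt -negb_or; apply/negP => /orP h.
    by move: zu; rewrite phi0_out// ltNge z0.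
  by case/andP: (u01) => -> _ /=; rewrite ltNge le_psi0// -ltNge.
move=> /andP[u0 uz].
have u1 : u <= 1 by rewrite (le_trans (ltW uz))// psi0_le1.
by rewrite ltNge -le_psi0 ?u0// -ltNge.
Qed.

Lemma phi0_derive u : 0 < u < 1 -> is_derive u 1 phi0 (- iter_tail m G (phi0 u))^-1.
Proof.
move=> u01; have u01' : 0 < u <= 1 by lra.
rewrite -[X in is_derive X](phi0K u01').
have z0 : 0 < phi0 u by rewrite -psi0_decr phi0K// psi0_0; lra.
have hK : \forall y \near phi0 u, phi0 (psi0 y) = y.
  by near=> y; apply: psi0K; apply: ltW; near: y; exact: lt_nbhsr.
have hc : \forall y \near phi0 u, {for y, continuous psi0}.
  by near=> y; exact: psi0_continuous.
apply: (@is_derive_inverse R psi0 phi0) => //.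
by rewrite oppr_eq0 gt_eqF// iter_tail_gt0.
Unshelve. all: by end_near. Qed.

Lemma phi0_continuous u : 0 < u -> {for u, continuous phi0}.
Proof.
move=> u0; have [u1|u1] := ltP u 1.
  by apply: is_derive_continuous (phi0_derive _); rewrite u0.
move: u1; rewrite le_eqVlt => /orP[/eqP <-|u1].
  rewrite /prop_for /continuous_at phi0_1; apply/cvgrPdist_lt => e e0.
  have he : psi0 e < 1 by rewrite -psi0_0 psi0_decr.
  near=> v; rewrite sub0r normrN ger0_norm ?phi0_ge0//.
  have [v1|v1] := leP v 1; last by rewrite phi0_out//; right.
  have v0 : 0 < v by near: v; apply: lt_nbhsr; exact: ltr01.
  by rewrite -lt_psi0 ?v0 ?v1//; near: v; exact: lt_nbhsr.
rewrite /prop_for /continuous_at.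
apply: cvg_near_cst; near=> v; rewrite !phi0_out//; right => //.
by near: v; exact: lt_nbhsr.
Unshelve. all: by end_near. Qed.

Let kappa := phi0 (2^-1).

Let kappa_gt0 : 0 < kappa.
Proof. by rewrite /kappa -psi0_decr phi0K ?psi0_0; lra. Qed.

(** Rescaling the argument by [kappa] gives [psi1 1 = 1/2] and cancels in the copula, so everything
    probabilistic is done with [psi0]. *)
Definition psi1 z := psi0 (kappa * z).

Let psi1_neq0 z : psi1 z <> 0.
Proof. by apply/eqP; rewrite gt_eqF// psi0_gt0. Qed.

Lemma psi1_arch_gen : arch_gen m.+2 psi1.
Proof.
have cz z : 0 <= z -> 0 <= kappa * z by move=> z0; rewrite mulr_ge0// ltW.
split; [split|split; [split|]].
- by move=> z z0; rewrite (ltW (psi0_gt0 _)) psi0_le1// cz.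
- apply: continuous_subspaceT => z.
  apply: (@continuous_comp _ _ _ (fun t => kappa * t) psi0); last exact: psi0_continuous.
  by apply: cvgMr; exact: cvg_id.
- by move=> x y _ xy; rewrite /psi1 psi0_nincr ler_pM2l.
- by rewrite /psi1 mulr0 psi0_0.
- apply: cvg_comp psi0_cvgy; apply/cvgryPge => A; near=> x.
  by rewrite mulrC -ler_pdivrMr//; near: x; exact: nbhs_pinfty_ge.
- by move=> x y _ xy _; rewrite /psi1 psi0_decr ltr_pM2l.
- by rewrite /psi1 mulr1 phi0K//; lra.
- move=> j jd x _; apply: derivable_tail => //.
  by move: jd; rewrite subSS subn1 => /ltnW; rewrite ltnS.
rewrite /= subSS subn1 /=.
have gE x : (-1) ^+ m * derive1n m psi1 x = kappa ^+ m * iter_tail 1 G (kappa * x).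
  rewrite derive1n_tail// subSn// subnn mulrA; congr (_ * _).
  by rewrite -exprMn mulrNN mul1r.
split.
- move=> x _; rewrite gE mulr_ge0 ?exprn_ge0 ?(ltW kappa_gt0)//.
  by rewrite ltW// iter_tail_gt0.
- move=> x y _ xy; rewrite !gE ler_pM2l ?exprn_gt0//; apply: iter_tail_nonincr => //.
  by rewrite ler_pM2l.
- move=> x y t _ _ t01; rewrite !gE.
  rewrite (_ : kappa * (t * x + _) = t * (kappa * x) + (1 - t) * (kappa * y)); last by ring.
  have := @tail_integral_convex _ G (kappa * x) (kappa * y) t Gd Gn t01.
  rewrite -(ler_pM2l (exprn_gt0 m kappa_gt0)) => /le_trans -> //.
  by rewrite le_eqVlt; apply/orP; left; apply/eqP; rewrite /iter_tail /=; ring.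
Unshelve. all: by end_near. Qed.

Definition arch_cop d (u : 'I_d -> R) : R :=
  if [forall i, 0 < u i] then psi0 (\sum_i phi0 (u i)) else 0.

Lemma arch_copulaE d (u : Rn R d) : cube01 u -> arch_copula psi1 u = arch_cop u.
Proof.
move=> u01; rewrite /arch_copula /arch_cop.
case: ifPn => [/forallP u0|/forallPn[i ui]].
  rewrite (_ : (\sum_(i < d) _)%E = (\sum_i phi0 (u i) / kappa)%:E); last first.
    rewrite -sumEFin; apply: eq_bigr => i _; rewrite /arch_phi.
    rewrite (_ : [set z | _] = [set phi0 (u i) / kappa]) ?image_set1 ?ereal_inf1//.
    have ui : 0 < u i <= 1 by rewrite u0; case/andP: (u01 i).
    apply/seteqP; split => z /=.
      move=> [z0 zu]; rewrite -zu /psi1 psi0K ?mulr_ge0 ?(ltW kappa_gt0)//.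
      by rewrite mulrAC divff ?mul1r// gt_eqF.
    move=> ->; split; first by rewrite mulr_ge0 ?phi0_ge0// invr_ge0 ltW.
    by rewrite /psi1 mulrCA divff ?mulr1 ?phi0K// gt_eqF.
  by rewrite /= /psi1 -mulr_suml mulrCA divff ?mulr1// gt_eqF.
(* As [psi1] never vanishes, [arch_phi psi1 0] is the infimum of the empty set; the other terms
   being nonnegative, the sum is infinite and [psi_ext] returns 0. *)
have ui0 : u i = 0 by apply/eqP; rewrite eq_le leNgt ui; case/andP: (u01 i).
have nonneg j : (0 <= arch_phi psi1 (u j))%E.
  by apply: le_ereal_inf_tmp => _ [z [z0 _] <-]; rewrite lee_fin.
suff -> : (\sum_(i < d) arch_phi psi1 (u i))%E = +oo%E by [].
rewrite (bigD1 i)//= ui0 (_ : arch_phi psi1 0 = +oo%E).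
  by rewrite addye// -ltNye (lt_le_trans _ (sume_ge0 _ _))// ltNyr.
by rewrite /arch_phi (_ : [set z | _] = set0) ?image_set0 ?ereal_inf0//;
  apply/seteqP; split => // z [_ /psi1_neq0].
Qed.

#[local] Hint Resolve psi0_gt0 phi0_ge0 : core.

(** * The law with the given copula *)

Hypothesis Gst : forall x y, 0 <= x -> x < y -> G y < G x.
Variable rho : {finite_measure set (measurableTypeR R) -> \bar R}.
Hypothesis rhoG : forall z, rho `[z, +oo[%classic = (G z)%:E.
Notation leb := (@lebesgue_measure R).
Notation Rm := (Rn R m.+1).
Notation Rm1 := (Rn R m.+2).

Lemma rho_itv_co x y : x <= y -> rho `[x, y[%classic = (G x - G y)%:E.
Proof.
move=> xy; have : rho (`[x, y[%classic `|` `[y, +oo[%classic) = (rho `[x, y[%classic + rho `[y, +oo[%classic)%E.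
  rewrite [LHS]measureU//.
  by apply/seteqP; split => // t []; rewrite /= !in_itv/= andbT => /andP[_]; rewrite ltNge => /negbTE ->.
rewrite (_ : `[x, y[ `|` `[y, +oo[%classic = `[x, +oo[%classic :> set R); last first.
  apply/seteqP; split => t; rewrite /= !in_itv/= !andbT.
    by move=> [/andP[]//|]; exact: le_trans.
  by move=> ->; have [?|?] := ltP t y; [left|right].
by rewrite !rhoG => h; rewrite EFinB h addeK.
Qed.

Lemma rho_set1 z : rho [set z] = 0%E.
Proof.
apply/eqP; rewrite eq_le measure_ge0 andbT; apply/lee_addgt0Pr => e e0; rewrite add0e.
have /cvgrPdist_le /(_ _ e0) H : {for z, continuous G} by case: Gd => h _; exact: h.
have [y [zy /= fy]] : exists y, z < y /\ `|G z - G y| <= e.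
  have h1 : \forall y \near z^'+, `|G z - G y| <= e by apply: cvg_within H.
  have h2 : \forall y \near z^'+, z < y by exact: nbhs_right_gt.
  have [y [? ?]] := @filter_ex _ _ (at_right_proper_filter z) _ (filterI h1 h2).
  by exists y.
apply: (@le_trans _ _ (rho `[z, y[%classic)).
  by apply: le_measure; rewrite ?inE//= => t -> /=; rewrite in_itv/= lexx zy.
by rewrite rho_itv_co ?(ltW zy)// lee_fin (le_trans _ fy)// ler_norm.
Qed.

Definition simplex_dom : set (Rm * measurableTypeR R) :=
  [set p | (forall i, 0 <= p.1 i) /\ \sum_i p.1 i <= p.2].

Definition radial_map (p : Rm * measurableTypeR R) : Rm1 :=
  fun i => psi0 (snoc (p.1, p.2 - \sum_i p.1 i) i).

Lemma measurable_simplex_dom : measurable simplex_dom.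
Proof.
rewrite (_ : simplex_dom =
  fst @^-1` [set x : Rm | forall i, `[0, +oo[%classic (x i)] `&`
  (fun p => p.2 - \sum_i p.1 i) @^-1` `[0, +oo[%classic); last first.
  apply/seteqP; split => p.
    move=> [h hp]; split; last by rewrite /= in_itv/= andbT subr_ge0.
    by move=> i; rewrite /= in_itv/= andbT.
  move=> [h]; rewrite /= in_itv/= andbT subr_ge0 => hp; split => // i.
  by have := h i; rewrite /= in_itv/= andbT.
apply: measurableI; rewrite -[X in measurable X]setTI.
  apply: measurable_fst => //.
  exact: (@measurable_Rn_rect _ _ (fun=> `[0, +oo[%classic) (fun=> measurable_itv _)).
apply: measurable_funB => //.
apply: (measurableT_comp (f := fun x : Rm => \sum_i x i)) => //.
exact: measurable_sum_coord.
Qed.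

Lemma measurable_radial_map : measurable_fun setT radial_map.
Proof.
pose h (p : Rm * measurableTypeR R) := (p.1, p.2 - \sum_i p.1 i) : Rm * measurableTypeR R.
have mh : measurable_fun setT h.
  apply/measurable_fun_pairP; split; first exact: measurable_fst.
  apply: measurable_funB; first exact: measurable_snd.
  exact: (measurableT_comp (@measurable_sum_coord R m.+1) measurable_fst).
apply: measurable_fun_Rn => i.
have ms := measurableT_comp (@measurable_coord R m.+2 i)
  (measurableT_comp (@measurable_snoc R m.+1) mh).
apply: measurableT_comp ms.
by apply: continuous_measurable_fun; exact: psi0_continuous.
Qed.

Definition arch_law : set Rm1 -> \bar R :=
  pushforward (mrestr (lebn R m.+1 \x rho)%E measurable_simplex_dom) radial_map.

Let arch_law0 : arch_law set0 = 0%E.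
Proof. by rewrite /arch_law /pushforward preimage_set0 measure0. Qed.

Let arch_law_ge0 A : (0 <= arch_law A)%E.
Proof. by rewrite /arch_law /pushforward; exact: measure_ge0. Qed.

Let arch_law_sigma_additive : semi_sigma_additive arch_law.
Proof. by apply: pushforward_semi_sigma_additive; exact: measurable_radial_map. Qed.

HB.instance Definition _ := isMeasure.Build _ _ _
  arch_law arch_law0 arch_law_ge0 arch_law_sigma_additive.

Lemma radial_mapP (P : 'I_m.+2 -> R -> Prop) p :
  (forall i, P i (radial_map p i)) <->
  (forall i, P (widen_ord (leqnSn m.+1) i) (psi0 (p.1 i))) /\
  P ord_max (psi0 (p.2 - \sum_i p.1 i)).
Proof.
exact: (snocP (p.1, p.2 - \sum_i p.1 i) (fun i t => P i (psi0 t)) (leqnSn m.+1)).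
Qed.

Lemma radial_map_gt0 p i : 0 < radial_map p i.
Proof. exact: psi0_gt0. Qed.

Lemma sum_phi0_radial p : simplex_dom p -> \sum_i phi0 (radial_map p i) = p.2.
Proof.
move=> [h hp]; have := sum_snoc (p.1, p.2 - \sum_i p.1 i); rewrite [RHS]addrC subrK => e.
rewrite -[RHS]e; apply: eq_bigr => i _; apply: psi0K; move: i.
apply/(@snocP R m.+1 _ (fun _ t => 0 <= t) (leqnSn m.+1)); split => [i|] /=; first exact: h.
by rewrite subr_ge0.
Qed.

Lemma arch_cop_radial p : simplex_dom p -> arch_cop (radial_map p) = psi0 p.2.
Proof.
move=> hp; rewrite /arch_cop; case: ifPn => [_|/forallPn[i]].
  by rewrite sum_phi0_radial.
by rewrite radial_map_gt0.
Qed.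

Lemma cube01_radial p : simplex_dom p -> cube01 (radial_map p).
Proof.
move=> [h hp] i; rewrite (ltW (radial_map_gt0 p i)) /= /radial_map psi0_le1//; move: i.
apply/(@snocP R m.+1 _ (fun _ t => 0 <= t) (leqnSn m.+1)); split => [i|] /=; first exact: h.
by rewrite subr_ge0.
Qed.

Definition arch_slice (A : set Rm1) (x : Rm) : set (measurableTypeR R) :=
  [set r | simplex_dom (x, r) /\ A (radial_map (x, r))].

Lemma arch_lawE A : arch_law A = (\int[lebn R m.+1]_x rho (arch_slice A x))%E.
Proof.
rewrite /arch_law /pushforward /mrestr /product_measure1; apply: eq_integral => x _ /=.
congr (rho _); apply/seteqP; split => r; rewrite /xsection/= inE /=.
  by move=> [].
by move=> [].
Qed.

Lemma measurable_arch_slice A (x : Rm) : measurable A -> measurable (arch_slice A x).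
Proof.
move=> mA; have mD : measurable (radial_map @^-1` A `&` simplex_dom).
  apply: measurableI; last exact: measurable_simplex_dom.
  by rewrite -[X in measurable X]setTI; exact: measurable_radial_map.
have := measurable_xsection x mD; congr (measurable _).
apply/seteqP; split => r; rewrite /xsection/= inE /=.
  by move=> [].
by move=> [].
Qed.

Lemma arch_law_eq0 A : measurable A -> (forall x : Rm, rho (arch_slice A x) = 0%E) -> arch_law A = 0%E.
Proof. by move=> mA h; rewrite arch_lawE integral0_eq. Qed.

(** The region contains a product of an open box and an interval of radii. The box has positive
    volume, and the interval has positive [rho]-mass by strict decrease of [G]. *)
Lemma arch_law_gt0 A (a b : 'I_m.+1 -> R) (al be : R) : measurable A ->
  (forall i, 0 <= a i < b i) -> 0 <= al < be ->
  (forall (x : Rm) r, (forall i, a i < x i < b i) -> al < r - \sum_i x i < be ->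
    A (radial_map (x, r))) ->
  (0 < arch_law A)%E.
Proof.
move=> mA ab /andP[al0 albe] h.
(* On a box with sides at most [e] the coordinate sum varies by less than half of [be - al], so one
   interval [[p, q[] of radii works for all [x] in the box. *)
pose e := (be - al) / (2 * m.+2%:R).
have m0 : 0 < m.+2%:R :> R by rewrite ltr0n.
have e0 : 0 < e by rewrite divr_gt0 ?subr_gt0// mulr_gt0.
pose b' i := Num.min (b i) (a i + e).
have ab' i : a i < b' i by rewrite lt_min; case/andP: (ab i) => _ ->; rewrite ltrDl.
pose B := [set x : Rm | forall i, `]a i, b' i[%classic (x i)].
have mB : measurable B.
  exact: (@measurable_Rn_rect _ _ (fun i => `]a i, b' i[%classic) (fun i => measurable_itv _)).
pose p := \sum_i a i + m.+1%:R * e + al; pose q := \sum_i a i + be.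
have pq : p < q.
  rewrite /p /q -addrA ltrD2l.
  have : m.+1%:R * e < m.+2%:R * e by rewrite ltr_pM2r// ltr_nat.
  have : m.+2%:R * e = (be - al) / 2.
    by rewrite /e; move: m0; move: (m.+2%:R) => M M0; field; rewrite gt_eqF.
  lra.
have p0 : 0 <= p.
  have sa : 0 <= \sum_i a i by apply: sumr_ge0 => i _; case/andP: (ab i).
  by rewrite /p !addr_ge0// mulr_ge0// ltW.
have mpq : measurable (`[p, q[%classic : set (measurableTypeR R)) by exact: measurable_itv.
have sub : B `*` `[p, q[%classic `<=` radial_map @^-1` A `&` simplex_dom.
  move=> [x r] [/= Bx]; rewrite in_itv/= => /andP[pr rq].
  have xb i : a i < x i < a i + e.
    by have := Bx i; rewrite /= in_itv/= /b' lt_min => /and3P[-> _ ->].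
  have s1 : \sum_i a i <= \sum_i x i by apply: ler_sum => i _; case/andP: (xb i) => /ltW.
  have s2 : \sum_i x i < \sum_i a i + m.+1%:R * e.
    rewrite -[X in X%:R](card_ord m.+1) mulr_natl -sumr_const -big_split /=.
    apply: ltr_sum => [|i _]; last by case/andP: (xb i).
    by apply/hasP; exists ord0; rewrite ?mem_index_enum.
  split.
    apply: h => [i|]; last by move: pr rq s1 s2; rewrite /p /q; lra.
    by have := Bx i; rewrite /= in_itv/= /b' lt_min => /and3P[-> ->].
  split => /= [i|]; last by move: pr s2; rewrite /p; lra.
  by have := xb i; case/andP: (ab i); lra.
apply: (@lt_le_trans _ _ ((lebn R m.+1 \x rho)%E (B `*` `[p, q[%classic))).
  rewrite product_measure1E// mule_gt0 ?lebn_open_box_gt0//.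
  rewrite [X in (0 < X)%E]rho_itv_co ?(ltW pq)// lte_fin subr_gt0.
  exact: Gst.
apply: le_measure => //; rewrite inE.
- exact: measurableX.
- apply: measurableI; last exact: measurable_simplex_dom.
  by rewrite -[X in measurable X]setTI; exact: measurable_radial_map.
Qed.

Lemma arch_law_ext (A B : set Rm1) :
  (forall p, simplex_dom p -> A (radial_map p) <-> B (radial_map p)) ->
  arch_law A = arch_law B.
Proof.
move=> AB; rewrite !arch_lawE; apply: eq_integral => x _; congr (rho _).
by apply/seteqP; split => r [h1 h2]; split => //; apply/(AB (x, r)).
Qed.

(** For fixed [x] above the corner [z], the condition on the last coordinate says that [r] is at
    least [phi0 (u ord_max) + sum x]; this half-line has mass [G] of its end, and integrating over
    the orthant rebuilds [psi0]. *)
Lemma arch_law_box (u : Rm1) : cube01 u ->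
  arch_law [set v : Rm1 | forall i, 0 <= v i <= u i] = (arch_cop u)%:E.
Proof.
move=> u01; rewrite arch_lawE /arch_cop.
case: ifPn => [/forallP u0|/forallPn[i ui]]; last first.
  rewrite integral0_eq// => x _.
  rewrite (_ : arch_slice _ x = set0) ?measure0//; apply/seteqP; split => // r [_ /(_ i)].
  by have := radial_map_gt0 (x, r) i; move: ui; rewrite -leNgt; lra.
have u1 i : 0 < u i <= 1 by rewrite u0; case/andP: (u01 i).
pose z i := phi0 (u (widen_ord (leqnSn m.+1) i)).
transitivity (\int[lebn R m.+1]_(x in [set x : Rm | forall i, `[z i, +oo[%classic (x i)])
    (G (phi0 (u ord_max) + \sum_i x i)%R)%:E)%E; last first.
  by rewrite integral_orthant// [in RHS]big_ord_recr /= addrC.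
rewrite [RHS]integral_mkcond; apply: eq_integral => x _; rewrite patchE.
case: ifPn => [/set_mem /= hx|/negP hx].
  have xz i : z i <= x i by have := hx i; rewrite /= in_itv/= andbT.
  rewrite -rhoG; congr (rho _); apply/seteqP; split => r.
    move=> [[h hr]] /(radial_mapP (fun i t => 0 <= t <= u i)) [_ /andP[_]] /=.
    by rewrite le_psi0// in_itv/= andbT lerBrDr.
  rewrite /= in_itv/= andbT => hr.
  have hr' : \sum_i x i <= r by apply: le_trans hr; rewrite lerDr phi0_ge0.
  split; first by split => //= i; apply: le_trans (xz i); exact: phi0_ge0.
  apply/(radial_mapP (fun i t => 0 <= t <= u i)); split => [i|] /=.
    by rewrite (ltW (psi0_gt0 _)) le_psi0//; exact: xz.
  by rewrite (ltW (psi0_gt0 _)) le_psi0// lerBrDr.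
rewrite (_ : arch_slice _ x = set0) ?measure0//; apply/seteqP; split => // r [_].
move=> /(radial_mapP (fun i t => 0 <= t <= u i)) [h _]; apply: hx; apply/mem_set => i /=.
by have /andP[_] := h i; rewrite /= le_psi0// in_itv/= andbT.
Qed.

Lemma arch_lawT : arch_law setT = 1%E.
Proof.
have c1 : cube01 ((fun=> 1) : Rm1) by move=> i; rewrite ler01 lexx.
rewrite (@arch_law_ext setT [set v : Rm1 | forall i, 0 <= v i <= 1]).
  rewrite (arch_law_box c1) /arch_cop ifT; last by apply/forallP => i.
  by under eq_bigr do rewrite phi0_1; rewrite sumr_const mul0rn psi0_0.
by move=> p /cube01_radial h; split.
Qed.

HB.instance Definition _ := Measure_isProbability.Build _ _ _ arch_law arch_lawT.

Definition arch_prob : probability Rm1 R := arch_law.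

Lemma measurable_cube01 n : measurable (@cube01 R n).
Proof.
rewrite (_ : cube01 = [set x : Rn R n | forall i, `[0, 1]%classic (x i)]).
  exact: (@measurable_Rn_rect _ _ (fun=> `[0, 1]%classic) (fun=> measurable_itv _)).
by apply/seteqP; split => x h i; have := h i; rewrite /= in_itv/=.
Qed.

Lemma measurable_sum_phi0 n : measurable_fun setT (fun v : Rn R n => \sum_i phi0 (v i)).
Proof.
apply: measurable_sum => i.
exact: (measurableT_comp measurable_phi0 (@measurable_coord R n i)).
Qed.

Lemma measurable_arch_cop : measurable_fun setT (fun v : Rm1 => arch_cop v).
Proof.
have mP : measurable [set v : Rm1 | forall i, `]0, +oo[%classic (v i)].
  exact: (@measurable_Rn_rect _ _ (fun=> `]0, +oo[%classic) (fun=> measurable_itv _)).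
rewrite (_ : (fun v : Rm1 => arch_cop v) = (fun v : Rm1 => psi0 (\sum_i phi0 (v i))) \_
   [set v : Rm1 | forall i, `]0, +oo[%classic (v i)]); last first.
  apply/funext => v; rewrite patchE /arch_cop.
  congr (if _ then _ else _); apply/forallP/idP => h.
    by apply/mem_set => i /=; rewrite in_itv/= h.
  by move=> i; have := set_mem h i; rewrite /= in_itv/= andbT.
apply/(measurable_restrictT _ mP); apply: measurable_funTS; apply: measurableT_comp.
  by apply: continuous_measurable_fun; exact: psi0_continuous.
exact: measurable_sum_phi0.
Qed.

Lemma measurable_cop_preimage (A : set R) : measurable A ->
  measurable [set v : Rm1 | A (arch_cop v)].
Proof. by move=> mA; rewrite -[X in measurable X]setTI; exact: measurable_arch_cop. Qed.

Lemma measurable_cop_itv s t : measurable [set w : Rm1 | s < arch_cop w <= t].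
Proof.
rewrite (_ : mkset _ = [set w : Rm1 | `]s, t]%classic (arch_cop w)]).
  exact: (measurable_cop_preimage (measurable_itv _)).
by apply/seteqP; split => w /=; rewrite in_itv.
Qed.

(** The copula depends on the radius alone, so each slice contains at most the radius [phi0 t], and
    [rho] has no atom. *)
Lemma arch_law_level t : arch_law [set v : Rm1 | arch_cop v = t] = 0%E.
Proof.
apply: arch_law_eq0 => [|x].
  exact: (measurable_cop_preimage (measurable_set1 t)).
apply/eqP; rewrite eq_le measure_ge0 andbT -(rho_set1 (phi0 t)).
apply: le_measure; rewrite ?inE//.
  apply: measurable_arch_slice; exact: (measurable_cop_preimage (measurable_set1 t)).
move=> r [hp /=]; rewrite arch_cop_radial//= => <-; rewrite psi0K//.
by case: hp => /= h; apply: le_trans; apply: sumr_ge0 => i _; exact: h.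
Qed.

Lemma arch_law_set1 (v : Rm1) : arch_law [set v] = 0%E.
Proof.
have m1 : measurable [set v].
  rewrite (_ : [set v] = [set w : Rm1 | forall i, [set v i] (w i)]).
    exact: (@measurable_Rn_rect _ _ (fun i => [set v i]) (fun=> measurable_set1 _)).
  by apply/seteqP; split => [w /= -> //|w /= h]; exact/funext.
apply/eqP; rewrite eq_le measure_ge0 andbT -(arch_law_level (arch_cop v)).
apply: le_measure; rewrite ?inE//; last by move=> w ->.
exact: (measurable_cop_preimage (measurable_set1 _)).
Qed.

Lemma arch_law_full_support : full_support01 arch_prob.
Proof.
move=> u u01 e e0.
have mA : measurable [set v : Rm1 | forall i, `]u i - e, u i + e[%classic (v i)].
  exact: (@measurable_Rn_rect _ _ (fun i => `]u i - e, u i + e[%classic) (fun=> measurable_itv _)).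
(* An interval of the variable [phi0] whose image lies near [u i]: far out when [u i = 0], otherwise
   to the right of [phi0 (u i)], so as to stay nonnegative even when [u i = 1]. *)
have H i : exists ab : R * R, 0 <= ab.1 < ab.2 /\
    forall x, ab.1 < x < ab.2 -> u i - e < psi0 x < u i + e.
  have /andP[] := u01 i; rewrite le_eqVlt => /orP[/eqP ui _|ui u1].
    have /cvgrPdist_lt /(_ _ e0) h := psi0_cvgy.
    have h2 : \forall y \near +oo, 0 <= y :> R by exact: nbhs_pinfty_ge.
    have [y [/= yu /= y0]] := filter_ex (filterI h h2); exists (y, y + 1) => /=.
    split; first by rewrite y0 ltrDl ltr01.
    move=> x /andP[yx _]; move: yu; rewrite sub0r normrN -ui sub0r add0r.
    rewrite gtr0_norm ?psi0_gt0// => yu; move: yx; rewrite -psi0_decr => yx.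
    by have := psi0_gt0 x; lra.
  have ui1 : 0 < u i <= 1 by rewrite ui u1.
  have /cvgrPdist_lt /(_ _ e0) := @psi0_continuous (phi0 (u i)).
  move=> /nbhs_ballP[dl /= d0 hd]; exists (phi0 (u i), phi0 (u i) + dl) => /=.
  split; first by rewrite phi0_ge0 ltrDl.
  move=> x /andP[x1 x2]; have hx : `|phi0 (u i) - x| < dl by rewrite ltr_norml; lra.
  by have := hd x hx; rewrite /= phi0K// ltr_norml; lra.
have [ab hab] := choice H.
rewrite (_ : mkset _ = [set v : Rm1 | forall i, `]u i - e, u i + e[%classic (v i)]); last first.
  by apply/seteqP; split => v h i; have := h i; rewrite /= in_itv/= ltr_norml; lra.
apply: (@arch_law_gt0 _ (fun i => (ab (widen_ord (leqnSn m.+1) i)).1)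
  (fun i => (ab (widen_ord (leqnSn m.+1) i)).2) (ab ord_max).1 (ab ord_max).2) => //.
- by move=> i; case: (hab (widen_ord (leqnSn m.+1) i)).
- by case: (hab ord_max).
- move=> x r h1 h2; apply/(radial_mapP (fun i => `]u i - e, u i + e[%classic)); split.
    by move=> i; rewrite /= in_itv/=; case: (hab (widen_ord (leqnSn m.+1) i)) => _; apply; exact: h1.
  by rewrite /= in_itv/=; case: (hab ord_max) => _; apply.
Qed.

Lemma psi0_lipschitz x y : 0 <= x -> x <= y ->
  psi0 x - psi0 y <= iter_tail m G 0 * (y - x).
Proof.
move=> x0 xy; have [w /andP[xw _] e] := MVT_tail (iter_tail_exp_dominated m Gd) xy.
rewrite [leLHS]e ler_wpM2r ?subr_ge0//; apply: iter_tail_nonincr => //.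
exact: le_trans xw.
Qed.

(** The set lies in the image under [psi0] of the nonnegative part of [N - s], and [psi0] is
    Lipschitz on the half-line. *)
Lemma phi0_negligible (N : set R) s : leb.-negligible N ->
  leb.-negligible [set y | 0 < y < 1 /\ N (s + phi0 y)].
Proof.
move=> [N' [mN' N'0 NN']].
have mphis : measurable_fun setT (fun y => s + phi0 y).
  by apply: measurable_funD => //; exact: measurable_phi0.
pose S := `]0, 1[%classic `&` (fun y => s + phi0 y) @^-1` N'.
have mS : measurable S.
  apply: measurableI; first exact: measurable_itv.
  by rewrite -[X in measurable X]setTI; exact: mphis.
exists S; split => //; last first.
  by move=> y [y01 /NN' ny]; split => //=; rewrite in_itv.
apply/eqP; rewrite eq_le measure_ge0 andbT; apply/lee_addgt0Pr => e e0; rewrite add0e.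
pose L := iter_tail m G 0.
have L0 : 0 < L by exact: iter_tail_gt0.
have [a [b [ab Nab sumab]]] := null_interval_cover (divr_gt0 e0 L0) N'0.
(* The intervals are cut at 0, which loses nothing as [phi0] is nonnegative and keeps them where the
   Lipschitz constant [L] is valid. *)
pose I k : set R := `[psi0 (Num.max (b k - s) 0), psi0 (Num.max (a k - s) 0)]%classic.
have mI k : measurable (I k) by exact: measurable_itv.
have SI : S `<=` \bigcup_k I k.
  move=> y [/=]; rewrite in_itv/= => y01 /Nab[k _]; rewrite /= in_itv/= => /andP[h1 h2].
  exists k => //; rewrite /I /= in_itv/=.
  rewrite -[X in _ <= X <= _](@phi0K y); last by lra.
  by rewrite !psi0_nincr le_max ge_max phi0_ge0 andbT; apply/andP; split; [apply/orP; left|]; lra.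
apply: (@le_trans _ _ (leb (\bigcup_k I k))).
  by apply: le_measure; rewrite ?inE//; exact: bigcupT_measurable.
apply: (le_trans (measure_sigma_subadditive _ _ _ (@subset_refl _ _))) => //.
  exact: bigcupT_measurable.
apply: (@le_trans _ _ (\sum_(0 <= k <oo) (L%:E * (b k - a k)%:E))%E).
  apply: lee_nneseries => // k _.
  suff : (leb (I k) <= L%:E * (b k - a k)%:E)%E by exact.
  rewrite (_ : leb (I k) = (psi0 (Num.max (a k - s) 0) - psi0 (Num.max (b k - s) 0))%:E); last first.
    rewrite /I lebesgue_measure_itv /= lte_fin; case: ltP => // h.
    by congr (_%:E); apply/esym/eqP; rewrite subr_eq0 eq_le h psi0_nincr ge_max !le_max lexx orbT !andbT lerD2r ab.
  have h1 : 0 <= Num.max (a k - s) 0 by rewrite le_max lexx orbT.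
  have h2 : Num.max (a k - s) 0 <= Num.max (b k - s) 0.
    by rewrite ge_max !le_max lexx orbT andbT lerD2r ab.
  rewrite -EFinM lee_fin; apply: (le_trans (psi0_lipschitz h1 h2)).
  rewrite ler_pM2l//; have := ab k.
  by case: (leP (a k - s) 0) => ?; case: (leP (b k - s) 0) => ?; lra.
rewrite nneseriesZl; last by move=> k _; rewrite lee_fin subr_ge0.
by rewrite muleC -lee_pdivlMr//; exact: (le_trans sumab).
Qed.

Lemma is_derive0_little_o (f : R -> R) x e : is_derive x 1 f 0 -> 0 < e ->
  \forall y \near x, `|f y - f x| <= e * `|y - x|.
Proof.
move=> [df f0] e0.
have D : (fun h => h^-1 *: ((f \o shift x) (h *: 1) - f x)) @ 0^' --> 'D_1 f x by exact: df.
rewrite f0 in D; move/cvgrPdist_le : D => /(_ _ e0); rewrite near_withinE => /nbhs_ballP[d /= d0 hd].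
apply/nbhs_ballP; exists d => //= y; rewrite /ball/= => yx.
have [->|nyx] := eqVneq y x; first by rewrite !subrr !normr0 mulr0.
have h0 : y - x != 0 by rewrite subr_eq0.
have hb : ball_ Num.norm 0 d (y - x) by rewrite /ball_ /= sub0r normrN distrC.
have := hd _ hb h0; rewrite /= [(y - x) *: 1]mulr1 subrK sub0r normrN normrM normfV.
by rewrite ler_pdivrMl ?normr_gt0// mulrC.
Qed.

Hypothesis Gder : {ae leb, forall x : R, is_derive x (1 : R) G (0 : R)}.

Lemma ae_derive_G_phi0 s :
  {ae leb, forall y : R, 0 < y < 1 -> is_derive y (1 : R) (fun t => G (s + phi0 t)) (0 : R)}.
Proof.
have : leb.-negligible [set y | 0 < y < 1 /\ ~ is_derive (s + phi0 y) (1 : R) G 0].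
  exact: (phi0_negligible s Gder).
apply: negligibleS => y /= /not_implyP[y01 ny]; split => // hG; apply: ny.
have h : is_derive y (1 : R) (fun t => s + phi0 t) (- iter_tail m G (phi0 y))^-1.
  by have := is_deriveD (is_derive_cst s y 1) (phi0_derive y01); rewrite add0r.
by have := @is_derive1_comp R G (fun t => s + phi0 t) y _ _ hG h; rewrite mul0r.
Qed.

Lemma ae_derive0_unit (F : R -> R) (c0 c1 : R) :
  (forall y, y < 0 -> F y = c0) -> (forall y, 1 < y -> F y = c1) ->
  {ae leb, forall y : R, 0 < y < 1 -> is_derive y (1 : R) F (0 : R)} ->
  {ae leb, forall y : R, is_derive y (1 : R) F (0 : R)}.
Proof.
move=> F0 F1 F01.
have n1 (z : R) : leb.-negligible [set z].
  by apply/negligibleP; [exact: measurable_set1|exact: lebesgue_measure_set1].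
have N01 := negligibleU (n1 0) (n1 1).
have := negligibleU F01 N01; apply: negligibleS => y /= ny.
have cst_der (c : R) : (\forall t \near y, F t = c) -> is_derive y (1 : R) F 0.
  move=> h; have hy := nbhs_singleton h; apply: is_derive_little_o => e e0.
  by apply: filterS h => t ->; rewrite hy subrr normr0 mulr_ge0// ltW.
have [y0|y0] := ltP y 0.
  case: ny; apply: (cst_der c0); near=> t; apply: F0.
  by near: t; exact: lt_nbhsl.
have [y1|y1] := ltP 1 y.
  case: ny; apply: (cst_der c1); near=> t; apply: F1.
  by near: t; exact: lt_nbhsr.
move: y0; rewrite le_eqVlt => /orP[/eqP <-|y0]; first by right; left.
move: y1; rewrite le_eqVlt => /orP[/eqP ->|y1]; first by right; right.
by left => /= h; apply: ny; apply: h; rewrite y0 y1.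
Unshelve. all: by end_near. Qed.

(** * The Kendall distribution function *)

Lemma measurable_rho_slice A : measurable A ->
  measurable_fun setT (fun w : Rm => rho (arch_slice A w)).
Proof.
move=> mA; have mD : measurable (radial_map @^-1` A `&` simplex_dom).
  apply: measurableI; last exact: measurable_simplex_dom.
  by rewrite -[X in measurable X]setTI; exact: measurable_radial_map.
have := measurable_fun_xsection rho mD; congr (measurable_fun _ _).
apply/funext => w /=; congr (rho _).
apply/seteqP; split => r; rewrite /xsection/= inE /=.
  by move=> [].
by move=> [].
Qed.

(** Each slice lies in the radii [[phi0 t, phi0 s[], of mass [G (phi0 t) - G (phi0 s)], and is
    nonempty only if [sum w < phi0 s], where [G (sum w) / G (phi0 s)] is at least 1. Inserting this
    factor bounds the integral over [w] by the normalisation of [G], with no simplex volume to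
    compute. *)
Lemma arch_law_cop_itv s t : 0 < s -> s < t -> t <= 1 ->
  (arch_law [set w : Rm1 | (s < arch_cop w <= t)%R] <=
   ((G (phi0 t) - G (phi0 s)) / G (phi0 s))%:E)%E.
Proof.
move=> s0 st t1; have t01 : 0 < t <= 1 by lra.
have s01 : 0 < s <= 1 by lra.
have mA := measurable_cop_itv s t.
have pst := phi0_decr s0 st t1.
have Gst' : 0 <= G (phi0 t) - G (phi0 s) by rewrite subr_ge0 Gn// ltW.
set k := _ / _; have k0 : 0 <= k by rewrite divr_ge0// ltW.
pose Z := [set w : Rm | forall i, `[0, +oo[%classic (w i)].
have mZ : measurable Z.
  exact: (@measurable_Rn_rect _ _ (fun=> `[0, +oo[%classic) (fun=> measurable_itv _)).
have mG : measurable_fun setT (fun w : Rm => (G (0 + \sum_i w i))%:E).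
  apply/measurable_EFinP; apply: measurableT_comp.
    by apply: continuous_measurable_fun; case: Gd.
  by apply: measurable_funD => //; exact: measurable_sum_coord.
have intG : (\int[lebn R m.+1]_(w in Z) (k%:E * (G (0 + \sum_i w i)%R)%:E) = k%:E)%E.
  rewrite ge0_integralZl_EFin//; last 2 first.
  - by move=> w _; rewrite lee_fin ltW.
  - exact: measurable_funTS.
  rewrite (@integral_orthant R m.+1 G (fun=> 0) 0 Gd) sumr_const mul0rn addr0 Gnorm.
  by rewrite mule1.
rewrite arch_lawE -intG [leRHS]integral_mkcond; apply: ge0_le_integral => //.
- exact: measurable_rho_slice.
- apply/(measurable_restrictT _ mZ); apply: measurable_funTS.
  by apply: measurable_funeM.
- move=> w _; rewrite patchE.
  have [->|/set0P[r0 [[hr0 sr0] hs0]]] := eqVneq (arch_slice [set w : Rm1 | s < arch_cop w <= t] w) set0.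
    by rewrite measure0; case: ifP => // _; rewrite mule_ge0// lee_fin// ltW.
  have sub r : arch_slice [set w : Rm1 | s < arch_cop w <= t] w r ->
      \sum_i w i <= r /\ phi0 t <= r < phi0 s.
    move=> [hp /=]; rewrite arch_cop_radial//= => /andP[h1 h2]; split; first by case: hp.
    by rewrite -le_psi0// h2 /= ltNge -le_psi0// -ltNge.
  have [hr1 /andP[_ hr2]] : \sum_i w i <= r0 /\ phi0 t <= r0 < phi0 s by exact: sub.
  rewrite ifT; last by apply/mem_set => i; rewrite /= in_itv/= andbT; exact: hr0.
  apply: (@le_trans _ _ (rho `[phi0 t, phi0 s[%classic)).
    apply: le_measure; rewrite ?inE//; first exact: measurable_arch_slice.
    by move=> r /sub[_]; rewrite /= in_itv.
  rewrite rho_itv_co ?(ltW pst)// -EFinM lee_fin add0r.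
  rewrite mulrAC ler_pdivlMr// ler_wpM2l// Gn//.
  by apply: ltW; exact: le_lt_trans hr2.
Qed.

Definition cop_df t := fine (arch_law [set w : Rm1 | arch_cop w <= t]).

Lemma cop_df_lipschitz s t : 0 < s -> s <= t -> t <= 1 ->
  0 <= cop_df t - cop_df s <= (G (phi0 t) - G (phi0 s)) / G (phi0 s).
Proof.
move=> s0; rewrite le_eqVlt => /orP[/eqP <- _|st t1]; first by rewrite !subrr mul0r lexx.
rewrite /cop_df (@distribution_diff _ _ _ arch_law _ measurable_arch_cop _ _ (ltW st)).
rewrite fine_ge0//= -lee_fin fineK; first exact: arch_law_cop_itv.
by apply: fin_num_measure; exact: measurable_cop_itv.
Qed.

Lemma cop_df_continuous : continuous cop_df.
Proof. exact: (@distribution_continuous _ _ _ arch_law _ measurable_arch_cop arch_law_level). Qed.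

Lemma cop_df_incr s t : 0 <= s -> s < t -> t <= 1 -> cop_df s < cop_df t.
Proof.
move=> s0 st t1; have t01 : 0 < t <= 1 by lra.
rewrite -subr_gt0 /cop_df (@distribution_diff _ _ _ arch_law _ measurable_arch_cop _ _ (ltW st)).
have mA := measurable_cop_itv s t.
rewrite -lte_fin fineK ?fin_num_measure//.
have [z tz sz] : exists2 z, phi0 t < z & s < psi0 z.
  have := s0; rewrite le_eqVlt => /orP[/eqP <-|s1].
    by exists (phi0 t + 1); rewrite ?ltrDl.
  have p := phi0_decr s1 st t1; exists ((phi0 t + phi0 s) / 2); first lra.
  rewrite ltNge le_psi0; last lra.
  by rewrite -ltNge; lra.
have pt0 := phi0_ge0 t.
(* The sum of the [w i] and the excess of [r - sum w] over [phi0 t] each use half of the room up to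
   [z], so the radius stays between [phi0 t] and [z]. *)
pose e := (z - phi0 t) / (2 * m.+1%:R).
have m0 : 0 < m.+1%:R :> R by rewrite ltr0n.
have e0 : 0 < e by rewrite divr_gt0 ?subr_gt0// mulr_gt0.
have me : m.+1%:R * e = (z - phi0 t) / 2.
  by rewrite /e; move: m0; move: (m.+1%:R) => M M0; field; rewrite gt_eqF.
apply: (@arch_law_gt0 _ (fun=> 0) (fun=> e) (phi0 t) ((phi0 t + z) / 2)) => //.
- by move=> i; rewrite lexx.
- by rewrite pt0; lra.
move=> w r h1 h2; rewrite /=.
have s1 : 0 <= \sum_i w i by apply: sumr_ge0 => i _; case/andP: (h1 i) => /ltW.
have s2 : \sum_i w i <= m.+1%:R * e.
  rewrite -[X in X%:R](card_ord m.+1) mulr_natl -sumr_const.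
  by apply: ler_sum => i _; case/andP: (h1 i) => _ /ltW.
rewrite arch_cop_radial /=; last first.
  split => /= [i|]; first by case/andP: (h1 i) => /ltW.
  by move: h2; lra.
rewrite le_psi0//; apply/andP; split; last by lra.
by apply: (lt_trans sz); rewrite psi0_decr; lra.
Qed.

Lemma cop_df_lt0 t : t < 0 -> cop_df t = 0.
Proof.
move=> t0; rewrite /cop_df (_ : mkset _ = set0) ?measure0//; apply/seteqP; split => // w /=.
rewrite leNgt (lt_le_trans t0)// /arch_cop; case: ifP => // _.
exact: ltW (psi0_gt0 _).
Qed.

Lemma cop_df_ge1 t : 1 <= t -> cop_df t = 1.
Proof.
move=> t1; rewrite /cop_df (_ : mkset _ = setT) ?arch_lawT//; apply/seteqP; split => // w _ /=.
rewrite (le_trans _ t1)// /arch_cop; case: ifP => // _; apply: psi0_le1.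
by apply: sumr_ge0 => i _.
Qed.

Lemma cop_df_derive : {ae leb, forall t : R, is_derive t (1 : R) cop_df (0 : R)}.
Proof.
apply: (@ae_derive0_unit _ 0 1).
- exact: cop_df_lt0.
- by move=> t /ltW; exact: cop_df_ge1.
have := ae_derive_G_phi0 0; apply: negligibleS => t /=; apply: contra_not => ht t01; move: (ht t01) => {}ht.
apply: is_derive_little_o => e e0.
(* Near [t] one has [phi0 s < phi0 t + 1], so [M] bounds the denominators [G (phi0 s)] uniformly;
   the zero derivative of [G] composed with [phi0], used with [e / M], then transfers to
   [cop_df]. *)
pose M := (G (phi0 t + 1))^-1.
have M0 : 0 < M by rewrite invr_gt0.
have h1 := is_derive0_little_o ht (divr_gt0 e0 M0).
have tt0 : 0 < t by lra.
have tt1 : t < 1 by lra.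
have pc : \forall s \near t, phi0 s < phi0 t + 1.
  have := phi0_continuous tt0; move/cvgrPdist_lt => /(_ 1 ltr01).
  by apply: filterS => s; rewrite ltr_norml; lra.
have Mle s : phi0 s < phi0 t + 1 -> (G (phi0 s))^-1 <= M.
  by move=> h; rewrite /M lef_pV2 ?posrE// Gn// ltW.
near=> s.
have s0 : 0 < s by near: s; exact: lt_nbhsr.
have s1 : s < 1 by near: s; exact: lt_nbhsl.
have ps : phi0 s < phi0 t + 1 by near: s.
have hs : `|G (0 + phi0 s) - G (0 + phi0 t)| <= e / M * `|s - t| by near: s.
rewrite !add0r in hs.
suff : `|cop_df s - cop_df t| <= `|G (phi0 s) - G (phi0 t)| * M.
  by move/le_trans; apply; rewrite -ler_pdivlMr// mulrAC.
have [st|ts] := leP s t.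
  have /andP[h2 h3] := cop_df_lipschitz s0 st (ltW tt1).
  rewrite distrC ger0_norm// (le_trans h3)// ler_pM ?invr_ge0 ?(ltW (G0 _))//.
  - rewrite subr_ge0 Gn//; move: st; rewrite le_eqVlt => /orP[/eqP->//|st].
    by rewrite ltW// phi0_decr// ltW.
  - by rewrite distrC ler_norm.
  - exact: Mle.
have /andP[h2 h3] := cop_df_lipschitz tt0 (ltW ts) (ltW s1).
rewrite ger0_norm// (le_trans h3)// ler_pM ?invr_ge0 ?(ltW (G0 _))//.
- by rewrite subr_ge0 Gn// ltW// phi0_decr// ltW.
- by rewrite ler_norm.
- by apply: Mle; rewrite ltrDl.
Unshelve. all: by end_near. Qed.

Lemma kendall_dfE t : kendall_df arch_prob (@arch_copula R m.+2 psi1) t = cop_df t.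
Proof.
rewrite /kendall_df /cop_df; congr fine; apply: arch_law_ext => p hp /=.
have hc := cube01_radial hp; split.
  by move=> [_]; rewrite arch_copulaE.
by move=> h; split => //; rewrite arch_copulaE.
Qed.

Lemma cop_df_cont_strict_singular : cont_strict_singular cop_df.
Proof.
split; [exact: cop_df_continuous|exact: cop_df_incr|exact: cop_df_derive].
Qed.

(** Here [w] is a point of the cube, so the sum called [s] in the overview is recovered through
    [phi0]. The test [0 < y] replaces the default of [phi0] at 0; beyond 1 that default makes the
    quotient equal to 1. *)
Definition cond_df (w : Rm) y : R :=
  if 0 < y then G (\sum_i phi0 (w i) + phi0 y) / G (\sum_i phi0 (w i)) else 0.

Lemma cond_df_continuous (w : Rm) : continuous (cond_df w).
Proof.
set s := \sum_i phi0 (w i); have cG : continuous G by case: Gd.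
move=> y; have [y0|] := ltP 0 y.
  have c1 : {for y, continuous (fun t => G (s + phi0 t) / G s)}.
    apply: cvgMl; apply: (@continuous_comp _ _ _ (fun t => s + phi0 t) G); last exact: cG.
    by apply: cvgD; [exact: cvg_cst|exact: phi0_continuous].
  rewrite /continuous_at {2}/cond_df y0; apply: cvg_trans c1; apply: near_eq_cvg.
  near=> t; rewrite /cond_df ifT//; near: t; exact: lt_nbhsr.
rewrite le_eqVlt => /orP[/eqP ->|y0]; last first.
  rewrite /continuous_at {2}/cond_df ltNge (ltW y0) /=; apply: cvg_near_cst.
  near=> t; rewrite /cond_df ltNge ifF//; apply/negbTE; rewrite negbK ltW//.
  by near: t; exact: lt_nbhsl.
(* Continuity at 0 from the right comes from infinity: [phi0 t] exceeds any [z] once [t < psi0 z],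
   and [G] tends to 0. *)
rewrite /continuous_at {2}/cond_df ltxx; apply/cvgrPdist_le => e e0.
have eG : 0 < e * G s by rewrite mulr_gt0.
have /cvgrPdist_le /(_ _ eG) h := exp_dominated_cvgy Gd.
have h2 : \forall z \near +oo, 0 <= z :> R by exact: nbhs_pinfty_ge.
have [z [/= hz /= z0]] := filter_ex (filterI h h2).
near=> t; rewrite sub0r normrN /cond_df; case: ifPn => t0; last by rewrite normr0 ltW.
rewrite ger0_norm ?divr_ge0 ?(ltW (G0 _))// ler_pdivrMr//.
have tz : t < psi0 z by near: t; apply: lt_nbhsl; exact: psi0_gt0.
have zt : z < phi0 t.
  rewrite ltNge -le_psi0 -?ltNge// t0 /=; apply: (le_trans (ltW tz)); exact: psi0_le1.
move: hz; rewrite sub0r normrN gtr0_norm//; apply: le_trans; apply: Gn.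
by rewrite (le_trans (ltW zt))// lerDr sumr_ge0.
Unshelve. all: by end_near. Qed.

Lemma cond_df_cont_strict_singular (w : Rm) : cont_strict_singular (cond_df w).
Proof.
set s := \sum_i phi0 (w i); have s0 : 0 <= s by apply: sumr_ge0.
split; first exact: cond_df_continuous.
  move=> x y x0 xy y1; rewrite /cond_df -/s (le_lt_trans x0 xy).
  case: ifPn => [x1|_]; last by rewrite divr_gt0.
  by rewrite ltr_pM2r ?invr_gt0// Gst ?addr_ge0// ltrD2l phi0_decr.
apply: (@ae_derive0_unit _ 0 1).
- by move=> y y0; rewrite /cond_df ltNge (ltW y0).
- by move=> y y1; rewrite /cond_df (lt_trans ltr01 y1) phi0_out ?addr0 ?divff ?gt_eqF//; right.
have := ae_derive_G_phi0 s; apply: negligibleS => t /=; apply: contra_not => ht t01.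
move: (ht t01) => {}ht; apply: is_derive_little_o => e e0.
have h1 := is_derive0_little_o ht (mulr_gt0 e0 (G0 s)).
have tt0 : 0 < t by lra.
near=> y.
have y0 : 0 < y by near: y; exact: lt_nbhsr.
have hy : `|G (s + phi0 y) - G (s + phi0 t)| <= e * G s * `|y - t| by near: y.
rewrite /cond_df y0 tt0 -/s -mulrBl normrM normfV (gtr0_norm (G0 s)).
by rewrite ler_pdivrMr// mulrAC.
Unshelve. all: by end_near. Qed.

Lemma measurable_cond_df y : measurable_fun setT (fun w : Rm => (cond_df w y)%:E).
Proof.
apply/measurable_EFinP; rewrite /cond_df; case: (0 < y); last exact: measurable_cst.
have mG : measurable_fun setT G by apply: continuous_measurable_fun; case: Gd.
have ms : measurable_fun setT (fun w : Rm => \sum_i phi0 (w i)) by exact: measurable_sum_phi0.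
apply: measurable_funM.
  by apply: (measurableT_comp mG); apply: measurable_funD.
apply: (measurableT_comp (f := fun t => (G t)^-1)) ms.
apply: continuous_measurable_fun => t; apply: cvgV; first by rewrite gt_eqF.
by case: Gd => cG _; exact: cG.
Qed.

Lemma cond_df_ge0 (w : Rm) y : (0 <= (cond_df w y)%:E)%E.
Proof. by rewrite lee_fin /cond_df; case: ifP => // _; rewrite divr_ge0// ltW. Qed.

(** * Disintegration along the first [d - 1] coordinates *)

Let psi_vec (w : Rm) : Rm := fun i => psi0 (w i).

Let init_radial p : init (radial_map p) = psi_vec p.1.
Proof.
apply/funext => i; rewrite /init /radial_map /psi_vec; congr psi0.
exact: (snoc_widen (p.1, p.2 - \sum_i p.1 i)).
Qed.

Let orthant : set Rm := [set w : Rm | forall i, `[0, +oo[%classic (w i)].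

(** In the variables [phi0] the marginal has density [G (sum w)] on the orthant: integrating out the
    radius leaves the [rho]-mass of the half-line from [sum w]. *)
Lemma integral_arch_marginal (A : set Rm) (h : Rm -> \bar R) :
  measurable A -> measurable_fun setT h -> (forall w, 0 <= h w)%E ->
  (\int[pushforward arch_law (@init R m.+2)]_(w in A) h w =
   \int[lebn R m.+1]_(w in orthant `&` psi_vec @^-1` A) (h (psi_vec w) * (G (\sum_i w i)%R)%:E))%E.
Proof.
move=> mA mh h0; have minit := @measurable_init R m.+2.
rewrite ge0_integral_pushforward//; last exact: measurable_funTS.
pose mu0 := mrestr (lebn R m.+1 \x rho)%E measurable_simplex_dom.
pose B := radial_map @^-1` (@init R m.+2 @^-1` A).
have mIA : measurable (@init R m.+2 @^-1` A).
  by rewrite -[X in measurable X]setTI; exact: minit.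
have mB : measurable B.
  by rewrite -[X in measurable X]setTI; exact: measurable_radial_map.
have mhi : measurable_fun setT (h \o @init R m.+2) by exact: measurableT_comp.
have mhr : measurable_fun setT ((h \o @init R m.+2) \o radial_map).
  by apply: (measurableT_comp mhi); exact: measurable_radial_map.
transitivity (\int[mu0]_(p in B) ((h \o @init R m.+2) \o radial_map) p)%E.
  have := @ge0_integral_pushforward _ _ _ _ R _ measurable_radial_map mu0
    (@init R m.+2 @^-1` A) (h \o @init R m.+2) mIA (measurable_funTS mhi).
  by apply => w _; exact: h0.
have mBD : measurable (B `&` simplex_dom).
  by apply: measurableI => //; exact: measurable_simplex_dom.
have mDc : measurable (~` simplex_dom) by apply: measurableC; exact: measurable_simplex_dom.
(* The complement of [simplex_dom] is null for the restricted measure; inside it the restriction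
   agrees with the product measure, to which Tonelli's theorem applies. *)
rewrite (@ge0_negligible_integral _ _ _ mu0 B (~` simplex_dom)) //; last 3 first.
- exact: measurable_funTS.
- by move=> p _; exact: h0.
- suff : (lebn R m.+1 \x rho)%E (~` simplex_dom `&` simplex_dom) = 0%E by exact.
  by rewrite setICl measure0.
rewrite setDE setCK (@eq_measure_integral _ _ _ _ (lebn R m.+1 \x rho)%E); last first.
  move=> C mC CB; suff : (lebn R m.+1 \x rho)%E (C `&` simplex_dom) = (lebn R m.+1 \x rho)%E C by exact.
  by rewrite setIidl// => p /CB[].
rewrite integral_mkcond fubini_tonelli1; last 2 first.
- by apply/(measurable_restrictT _ mBD); exact: measurable_funTS.
- by move=> p; apply: erestrict_ge0 => q _; exact: h0.
rewrite [RHS]integral_mkcond; apply: eq_integral => w _; rewrite /fubini_F patchE.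
have eB r : (B `&` simplex_dom) (w, r) = ((orthant `&` psi_vec @^-1` A) w /\ \sum_i w i <= r).
  apply/propext; rewrite /B /= init_radial /simplex_dom /orthant /=; split.
    by move=> [h1 [h2 h3]]; split => //; split => // i; rewrite /= in_itv/= andbT.
  by move=> [[h1 h2] h3]; split => //; split => // i; have := h1 i; rewrite /= in_itv/= andbT.
case: ifPn => [/set_mem hw|/negP hw].
  transitivity (\int[rho]_(r in `[(\sum_i w i)%R, +oo[) cst (h (psi_vec w)) r)%E.
    rewrite [RHS]integral_mkcond; apply: eq_integral => r _; rewrite !patchE /= init_radial.
    congr (if _ then _ else _); apply/idP/idP => /set_mem.
      by rewrite eB => -[_ hr]; apply/mem_set; rewrite /= in_itv/= andbT.
    by rewrite /= in_itv/= andbT => hr; apply/mem_set; rewrite eB.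
  rewrite [LHS]integral_cst; last exact: measurable_itv.
  by congr (_ * _)%E; exact: rhoG.
rewrite integral0_eq// => r _; rewrite patchE; case: ifPn => // /set_mem.
by rewrite eB => -[hA _]; case: hw; exact/mem_set.
Qed.

(** For [y > 0] the marginal density cancels the denominator of [cond_df], leaving [G (s + phi0 y)]:
    exactly the mass of the radii that put the last coordinate below [y]. *)
Lemma arch_law_cond (A : set Rm) y : measurable A ->
  arch_law [set w : Rm1 | A (init w) /\ (0 <= lastc w <= y)%R] =
  (\int[pushforward arch_law (@init R m.+2)]_(w in A) (cond_df w y)%:E)%E.
Proof.
move=> mA; rewrite integral_arch_marginal//; last 2 first.
- exact: measurable_cond_df.
- by move=> w; exact: cond_df_ge0.
rewrite arch_lawE [RHS]integral_mkcond; apply: eq_integral => w _; rewrite patchE.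
case: ifPn => [/set_mem[ow Aw]|/negP hw]; last first.
  rewrite (_ : arch_slice _ w = set0) ?measure0//; apply/seteqP; split => // r [[h1 h2] [/=]].
  rewrite init_radial => Aw _; apply: hw; apply/mem_set; split => // i.
  by rewrite /= in_itv/= andbT; exact: h1.
have w0 i : 0 <= w i by have := ow i; rewrite /= in_itv/= andbT.
have sw : \sum_i phi0 (psi_vec w i) = \sum_i w i.
  by apply: eq_bigr => i _; rewrite /psi_vec psi0K.
have lastE r : radial_map (w, r) ord_max = psi0 (r - \sum_i w i).
  by rewrite /radial_map snoc_max.
rewrite /cond_df sw; case: ifPn => y0; last first.
  rewrite mul0e (_ : arch_slice _ w = set0) ?measure0//; apply/seteqP; split => // r [_ [_]].
  rewrite /= lastE => /andP[_ h]; move: y0; rewrite -leNgt => y0.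
  by have := psi0_gt0 (r - \sum_i w i); lra.
rewrite -EFinM divfK ?gt_eqF// -rhoG; congr (rho _); apply/seteqP; split => r.
  move=> [[_ /= sr] [_ /=]]; rewrite lastE in_itv/= andbT => /andP[_].
  have [y1|y1] := leP y 1; first by rewrite le_psi0 ?y0// lerBrDl.
  by rewrite phi0_out ?addr0//; right.
rewrite /= in_itv/= andbT => hr.
have hr' : \sum_i w i <= r by apply: le_trans hr; rewrite lerDl.
split; first by split.
split; first by rewrite init_radial.
rewrite lastE (ltW (psi0_gt0 _)) /=; have [y1|/ltW y1] := leP y 1.
  by rewrite le_psi0 ?y0// lerBrDl.
by apply: le_trans y1; rewrite psi0_le1// subr_ge0.
Qed.

(** For each [y] the kernel agrees with [cond_df] off a null set that depends on [y]. Uniting these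
    sets over rational [y] gives one null set; off it, monotonicity in [y] of the kernel and
    continuity of [cond_df] extend the equality to all real [y]. *)
Lemma arch_law_kernel (K : R.-pker Rm ~> R) :
  markov_kernel_of arch_prob K ->
  ae_marg arch_prob (fun w : Rm => cont_strict_singular
    (fun y => fine (K w [set z : R | 0 <= z <= y]))).
Proof.
move=> hK; pose B y := [set z : R | 0 <= z <= y].
have mB y : measurable (B y).
  rewrite (_ : B y = `[0, y]%classic); first exact: measurable_itv.
  by apply/seteqP; split => z; rewrite /= in_itv.
pose nu := measure_function_pushforward__canonical__measure_function_Measure
  arch_law (@measurable_init R m.+2).
have aeq y : ae_eq nu setT (fun w : Rm => (cond_df w y)%:E) (fun w : Rm => K w (B y)).
  apply: integral_ae_eq => //.
  - apply/integrableP; split; first exact: measurable_cond_df.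
    under eq_integral do rewrite gee0_abs ?cond_df_ge0//.
    have := @arch_law_cond setT y measurableT => <-.
    apply: (@le_lt_trans _ _ 1%E); last exact: ltry.
    apply: probability_le1.
    rewrite (_ : mkset _ = (@lastc R m.+2) @^-1` B y); last first.
      by apply/seteqP; split => w /=; [move=> []|].
    by rewrite -[X in measurable X]setTI; exact: measurable_lastc.
  - exact: measurable_kernel.
  - move=> A _ mA; rewrite -[LHS]arch_law_cond//; exact: hK.
pose bad (q : rat) : set Rm := [set w : Rm | (cond_df w (ratr q))%:E <> K w (B (ratr q))].
have Nq q : nu.-negligible (bad q).
  by apply: negligibleS (aeq (ratr q)) => w /= h /(_ I).
pose badn n := if unpickle n is Some q then bad q else set0.
have Nn n : nu.-negligible (badn n).
  by rewrite /badn; case: unpickle => [q|]; [exact: Nq|by apply: negligibleS (Nq 0) => w []].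
have [N [mN N0 sub]] := negligible_bigcup Nn.
exists N; split => // w Nw.
have Kq (q : rat) : fine (K w (B (ratr q))) = cond_df w (ratr q).
  have h : (cond_df w (ratr q))%:E = K w (B (ratr q)).
    apply: contrapT => hw.
    have hb : badn (pickle q) w.
      rewrite /badn pickleK; exact: hw.
    exact: (Nw (sub w (ex_intro2 _ _ (pickle q) I hb))).
  by rewrite -h.
have Kle y y' : y <= y' -> fine (K w (B y)) <= fine (K w (B y')).
  have fK t : K w (B t) \is a fin_num.
    rewrite ge0_fin_numE// (@le_lt_trans _ _ (K w setT))//.
      by apply: le_measure; rewrite ?inE//.
    by rewrite prob_kernel ltry.
  move=> yy; apply: fine_le; [exact: fK|exact: fK|].
  apply: le_measure; rewrite ?inE//.
  by move=> z /= /andP[z0 zy]; rewrite /B /= z0; exact: le_trans yy.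
suff -> : (fun y => fine (K w (B y))) = cond_df w by exact: cond_df_cont_strict_singular.
apply/funext => y.
have cF : {for y, continuous (cond_df w)} by exact: cond_df_continuous.
apply/eqP; rewrite eq_le; apply/andP; split; apply/ler_addgt0Pr => e e0.
  have /cvgrPdist_lt /(_ _ e0) /nbhs_ballP[dl /= d0 hd] := cF.
  have [q] := @rat_in_itvoo R y (y + dl) ltac:(by rewrite ltrDl).
  rewrite in_itv/= => /andP[yq qd]; apply: (le_trans (Kle _ _ (ltW yq))); rewrite Kq.
  have : ball y dl (ratr q) by rewrite /ball /= ltr_norml; lra.
  by move=> /hd /=; rewrite ltr_norml; lra.
have /cvgrPdist_lt /(_ _ e0) /nbhs_ballP[dl /= d0 hd] := cF.
have [q] := @rat_in_itvoo R (y - dl) y ltac:(by rewrite ltrBlDr ltrDl).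
rewrite in_itv/= => /andP[qd qy]; rewrite -lerBlDr; apply: (le_trans _ (Kle _ _ (ltW qy))); rewrite Kq.
have : ball y dl (ratr q) by rewrite /ball /= ltr_norml; lra.
by move=> /hd /=; rewrite ltr_norml; lra.
Qed.

(** * The carrier of the law is Lebesgue-null *)

Definition slab (M a b : R) : set Rm1 := [set v : Rm1 | exists x : 'I_m.+2 -> R,
  [/\ forall i, 0 <= x i <= M, a <= \sum_i x i <= b & forall i, v i = psi0 (x i)]].

(* The first [m.+1] coordinates range over a grid of mesh [h] in the variables
   [phi0 (v i)]; the last one is then confined to an interval of length at most
   [m.+2 * h], and the grid cells, transported by [psi0], have total volume at
   most 1 whatever [M] is. *)
Lemma slab_box_cover M a b h : 0 < h -> a <= b -> b - a <= h -> 0 <= M ->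
  box_cover (slab M a b) (iter_tail m G 0 * (m.+2%:R * h))%:E.
Proof.
move=> h0 ab bah M0.
pose g := (Num.truncn (M / h)).+1.
have Mg : M < g%:R * h by rewrite -ltr_pdivrMr// truncnS_gt.
pose I := {ffun 'I_m.+1 -> 'I_g}.
pose lo (f : I) : Rm := fun i => (f i)%:R * h.
pose hi (f : I) : Rm := fun i => (f i).+1%:R * h.
pose pos t := Num.max t 0.
have pos_ge0 t : 0 <= pos t by rewrite /pos le_max lexx orbT.
have pos_le s t : s <= t -> pos s <= pos t.
  by move=> st; rewrite /pos ge_max !le_max st lexx orbT.
have pos_lip s t : s <= t -> pos t - pos s <= t - s.
  by rewrite /pos => st; case: (leP t 0) => ?; case: (leP s 0) => ?; lra.
(* As [psi0] reverses the order, lower corners come from upper ends of cells. The last variable lies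
   between [a - sum hi] and [b - sum lo]; cutting at 0 keeps it where [psi0_lipschitz] holds. *)
pose A (f : I) : Rm1 := snoc ((fun i => psi0 (hi f i)) : Rm, psi0 (pos (b - \sum_i lo f i))).
pose B (f : I) : Rm1 := snoc ((fun i => psi0 (lo f i)) : Rm, psi0 (pos (a - \sum_i hi f i))).
have lohi f i : lo f i <= hi f i by rewrite /lo /hi ler_pM2r// ler_nat.
have slohi f : \sum_i hi f i = \sum_i lo f i + m.+1%:R * h.
  rewrite -[X in X%:R](card_ord m.+1) mulr_natl -sumr_const -big_split /=.
  by apply: eq_bigr => i _; rewrite /hi /lo -natr1 mulrDl mul1r.
have AB f i : A f i <= B f i.
  rewrite /A /B /snoc; case: (insub _) => [j|] /=; rewrite psi0_nincr//.
  by apply: pos_le; rewrite lerB//; apply: ler_sum => j _.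
have len0 j : 0 <= psi0 (j%:R * h) - psi0 (j.+1%:R * h).
  by rewrite subr_ge0 psi0_nincr ler_pM2r// ler_nat.
have cover : slab M a b `<=` \bigcup_(f in setT) box (A f) (B f).
  move=> v [x [xM sx vx]].
  have cell (i : 'I_m.+1) : exists j : 'I_g, j%:R * h <= x (widen_ord (leqnSn m.+1) i) <= j.+1%:R * h.
    set y := x _; have /andP[y0 yM] : 0 <= y <= M := xM _.
    have jg : (Num.truncn (y / h) < g)%N.
      by rewrite truncn_lt_nat ?divr_ge0 ?(ltW h0)// ltr_pdivrMr//; exact: le_lt_trans Mg.
    exists (Ordinal jg) => /=; have /truncn_itv/andP[h1 h2] : 0 <= y / h by rewrite divr_ge0// ltW.
    by rewrite -ler_pdivlMr// h1 /= -ler_pdivrMr// ltW.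
  have [f hf] := choice cell.
  pose F : I := [ffun i => f i].
  have hF i : lo F i <= x (widen_ord (leqnSn m.+1) i) <= hi F i by rewrite /lo /hi ffunE.
  exists F => // i; rewrite vx; move: i; apply/(ord_recrP _ (leqnSn m.+1)); split.
    by move=> i; rewrite /A /B !snoc_widen /= !psi0_nincr; case/andP: (hF i) => -> ->.
  rewrite /A /B !snoc_max /= !psi0_nincr.
  move: sx; rewrite big_ord_recr /=; set S := \sum_(i < m.+1) _; set xl := x ord_max => sx.
  have sl : \sum_i lo F i <= S by apply: ler_sum => i _; case/andP: (hF i).
  have sh : S <= \sum_i hi F i by apply: ler_sum => i _; case/andP: (hF i).
  have /andP[xl0 _] := xM ord_max; rewrite -/xl in xl0.
  by rewrite /pos le_max ge_max xl0 andbT; apply/andP; split; [apply/orP; left|]; lra.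
apply: (box_cover_sub cover).
have [a' [b' [h1 h2 h3]]] := @box_cover_fin R m.+2 I A B isT AB.
exists a', b'; split => //; apply: (le_trans h3); rewrite lee_fin.
pose len (j : 'I_g) := psi0 (j%:R * h) - psi0 (j.+1%:R * h).
apply: (@le_trans _ _ (\sum_(f : I) (\prod_(i < m.+1) len (f i)) * (iter_tail m G 0 * (m.+2%:R * h)))).
  apply: ler_sum => f _; rewrite /box_vol big_ord_recr /= {2}/A {2}/B !snoc_max /=.
  rewrite (eq_bigr (fun i => len (f i))); last first.
    by move=> i _; rewrite /A /B !snoc_widen.
  apply: ler_wpM2l; first by apply: prodr_ge0 => i _; exact: len0.
  have sab : a - \sum_i hi f i <= b - \sum_i lo f i.
    by rewrite lerB//; apply: ler_sum => i _.
  apply: le_trans (psi0_lipschitz (pos_ge0 _) (pos_le _ _ sab)) _.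
  rewrite ler_wpM2l ?(ltW (iter_tail_gt0 _ _ _ _))//.
  apply: le_trans (pos_lip _ _ sab) _; rewrite slohi.
  by rewrite -[m.+2%:R]natr1 mulrDl mul1r; lra.
(* By distributivity the sum over all cells is the power [m.+1] of a telescoping sum, which is at
   most [psi0 0 = 1]. *)
rewrite -mulr_suml -(bigA_distr_bigA (fun (_ : 'I_m.+1) j => len j)) /= prodr_const card_ord ler_piMl//.
  by rewrite !mulr_ge0// ?ler0n ?(ltW h0)// ltW// iter_tail_gt0.
have -> : \sum_(j < g) len j = psi0 0 - psi0 (g%:R * h).
  rewrite /len; elim: g {Mg I lo hi A B lohi slohi AB cover a' b' h1 h2 h3 len} => [|k IH].
    by rewrite big_ord0 mul0r subrr.
  by rewrite big_ord_recr /= IH; ring.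
rewrite psi0_0; apply: exprn_ile1; last by rewrite gerBl ltW.
by rewrite subr_ge0 psi0_le1// mulr_ge0// ltW.
Qed.

Lemma slab_null (E : set R) M : 0 <= M -> leb E = 0%E ->
  leb_null [set v : Rm1 | exists x : 'I_m.+2 -> R,
    [/\ forall i, 0 <= x i <= M, E (\sum_i x i) & forall i, v i = psi0 (x i)]].
Proof.
move=> M0 E0 e e0.
pose C := iter_tail m G 0 * m.+2%:R.
have C0 : 0 < C by rewrite mulr_gt0 ?ltr0n// iter_tail_gt0.
pose e2 := e / C / 2.
have e20 : 0 < e2 by rewrite !divr_gt0.
have [a [b [ab Eab sab]]] := null_interval_cover e20 E0.
(* The added term keeps the mesh positive when the interval is degenerate. The lengths and these
   additions each use half of [e / C]. *)
pose h k := (b k - a k) + e2 / (2 ^ k.+1)%:R.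
have hgt k : b k - a k < h k by rewrite ltrDl divr_gt0// ltr0n expn_gt0.
have h0 k : 0 < h k by apply: le_lt_trans (hgt k); rewrite subr_ge0.
have := box_cover_bigcup (fun k => slab_box_cover (h0 k) (ab k) (ltW (hgt k)) M0).
move=> [a' [b' [h1 h2 h3]]]; exists a', b'; split => //.
  apply: subset_trans h2 => v [x [xM Ex vx]]; have [k _ hk] := Eab _ Ex.
  exists k => //; exists x; split => //.
  by move: hk; rewrite /= in_itv/= => /andP[/ltW -> ->].
apply: (le_trans h3).
apply: (@le_trans _ _ (\sum_(0 <= k <oo) (C%:E * ((b k - a k)%:E + (e2 / (2 ^ k.+1)%:R)%:E)))%E).
  apply: lee_nneseries => k _; first by rewrite lee_fin mulrA mulr_ge0// ltW.
  by rewrite -EFinD -EFinM lee_fin /C /h mulrA.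
rewrite nneseriesZl; last by move=> k _; rewrite -EFinD lee_fin ltW// h0.
rewrite muleC -lee_pdivlMr//.
have ba0 k : (0 <= (b k - a k)%:E)%E by rewrite lee_fin subr_ge0.
apply: (le_trans (epsilon_trick xpredT ba0 (ltW e20))).
apply: (le_trans (leeD sab (lexx _))).
by rewrite -EFinD lee_fin /e2; lra.
Qed.

Definition cop_support (E : set R) : set Rm1 :=
  [set v : Rm1 | (forall i, 0 < v i <= 1) /\ E (\sum_i phi0 (v i))].

Lemma cop_support_null (E : set R) : leb E = 0%E -> leb_null (cop_support E).
Proof.
move=> E0 e e0.
pose F M := [set v : Rm1 | exists x : 'I_m.+2 -> R,
    [/\ forall i, 0 <= x i <= M%:R, E (\sum_i x i) & forall i, v i = psi0 (x i)]].
have FM M : box_cover (F M) (e / (2 ^ M.+1)%:R)%:E.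
  by apply: slab_null => //; rewrite divr_gt0// ltr0n expn_gt0.
have [a [b [h1 h2 h3]]] := box_cover_bigcup FM; exists a, b; split => //.
  apply: subset_trans h2 => v [v01 Ev].
  (* A common bound for the finitely many [phi0 (v i)]; the slab estimate needs bounded variables,
     so the half-lines are exhausted by integers [M], with budget [e / 2 ^ M.+1] each. *)
  exists (\sum_i (Num.truncn (phi0 (v i))).+1)%N => //; exists (fun i => phi0 (v i)); split => //.
    move=> i; rewrite phi0_ge0 /=; apply: (le_trans (ltW (truncnS_gt _))).
    by rewrite ler_nat (bigD1 i)//= leq_addr.
  by move=> i; rewrite phi0K.
apply: (le_trans h3).
by apply: epsilon_trick0; exact: ltW.
Qed.

Lemma arch_law_is_measure_of : is_measure_of (@arch_copula R m.+2 psi1) arch_prob.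
Proof. by move=> u u01; rewrite arch_copulaE//; exact: arch_law_box. Qed.

Lemma arch_law_singular (E : set R) : measurable E -> leb E = 0%E -> rho (~` E) = 0%E ->
  singular_leb arch_prob.
Proof.
move=> mE E0 rhoE.
have mN : measurable (cop_support E).
  rewrite (_ : cop_support E = [set v : Rm1 | forall i, `]0, 1]%classic (v i)] `&`
    (fun v : Rm1 => \sum_i phi0 (v i)) @^-1` E); last first.
    by apply/seteqP; split => v [h Ev]; split => // i; have := h i; rewrite /= in_itv.
  apply: measurableI.
    exact: (@measurable_Rn_rect _ _ (fun=> `]0, 1]%classic) (fun=> measurable_itv _)).
  by rewrite -[X in measurable X]setTI; exact: measurable_sum_phi0.
exists (cop_support E); split => //; first exact: cop_support_null.
apply: arch_law_eq0; first exact: measurableC.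
move=> w; apply/eqP; rewrite eq_le measure_ge0 andbT -rhoE.
apply: le_measure; rewrite ?inE.
- by apply: measurable_arch_slice; exact: measurableC.
- exact: measurableC.
move=> r [hp hn] Er; apply: hn; split; last by rewrite sum_phi0_radial.
by move=> i; rewrite radial_map_gt0; case/andP: (cube01_radial hp i).
Qed.

Lemma arch_law_level_set t :
  measurable (level_set (@arch_copula R m.+2 psi1) t) /\
  arch_prob (level_set (@arch_copula R m.+2 psi1) t) = 0%E.
Proof.
have mt := measurable_cop_preimage (measurable_set1 t).
have -> : level_set (@arch_copula R m.+2 psi1) t = cube01 `&` [set w : Rm1 | arch_cop w = t].
  by apply/seteqP; split => w [w01 <-]; split => //=; rewrite arch_copulaE.
have mI : measurable (cube01 `&` [set w : Rm1 | arch_cop w = t]).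
  by apply: measurableI => //; exact: measurable_cube01.
split => //; apply/eqP; rewrite eq_le measure_ge0 andbT -(arch_law_level t).
by apply: le_measure; rewrite ?inE.
Qed.

End Generator.

(** * Normalisation and conclusion *)

Lemma tail_integralZ (R : realType) (f : R -> R) a s : exp_dominated f -> 0 <= a ->
  tail_integral (fun z => a * f z) s = a * tail_integral f s.
Proof.
move=> fd a0; have [cf [A fA]] := fd; rewrite /tail_integral.
under eq_integral do rewrite EFinM.
rewrite ge0_integralZl_EFin ?fineM//.
- by rewrite tail_integralE.
- by move=> x _; rewrite lee_fin; case/andP: (fA x).
- by apply/measurable_EFinP; apply: measurable_funTS; exact: continuous_measurable_fun.
Qed.

Lemma iter_tailZ (R : realType) k (f : R -> R) a : exp_dominated f -> 0 <= a ->
  iter_tail k (fun z => a * f z) = (fun z => a * iter_tail k f z).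
Proof.
move=> fd a0; elim: k => //= k ->; apply/funext => z.
by rewrite tail_integralZ//; exact: iter_tail_exp_dominated.
Qed.

Lemma tail_sum_exp_dominated (R : realType) : exp_dominated (@tail_sum R).
Proof.
split; first exact: tail_sum_continuous.
by exists 2 => x; rewrite tail_sum_ge0 tail_sum_le_exp.
Qed.

Lemma tail_sum_gt0 (R : realType) (z : R) : 0 < tail_sum z.
Proof.
have z0 : 0 <= Num.max z 0 by rewrite le_max lexx orbT.
apply: (@lt_le_trans _ _ (tail_sum (Num.max z 0))); last first.
  by apply: tail_sum_nonincr; rewrite le_max lexx.
have z1 : Num.max z 0 < Num.max z 0 + 1 by rewrite ltrDl.
exact: le_lt_trans (tail_sum_ge0 _) (tail_sum_decr z0 z1).
Qed.

Unset Implicit Arguments.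

Theorem theorem6p1 (R : realType) (d : nat) (hd : (3 <= d)%N) :
  exists psi : R -> R, arch_gen d psi /\
  exists mu : probability (Rn R d) R,
    is_measure_of (@arch_copula R d psi) mu /\
    (* (1) *)
    [/\ singular_leb mu,
        (forall u : Rn R d, mu [set u] = 0%E) &
        full_support01 mu ] /\
    (* (2) *)
    (forall K : R.-pker (Rn R d.-1) ~> R, markov_kernel_of mu K ->
       ae_marg mu (fun x => cont_strict_singular
                              (fun y => fine (K x [set z : R | 0 <= z <= y])))) /\
    (* (3) *)
    (forall t : R, 0 <= t <= 1 ->
       measurable (level_set (@arch_copula R d psi) t) /\
       mu (level_set (@arch_copula R d psi) t) = 0%E) /\
    (* (4) *)
    cont_strict_singular (kendall_df mu (@arch_copula R d psi)).
Proof.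
have [m ->] : exists m, d = m.+2.
  by exists (d - 2)%N; rewrite -addn2 subnK// ltnW.
(* The total mass before normalisation. Dividing both the tail and the measure by [N] preserves
   [rhoG] and yields [psi0 0 = 1]. *)
pose N := iter_tail m.+1 (@tail_sum R) 0.
have dom := @tail_sum_exp_dominated R.
have N0 : 0 < N by apply: iter_tail_gt0 => // z; exact: tail_sum_gt0.
have a0 : 0 < N^-1 by rewrite invr_gt0.
pose G z := N^-1 * tail_sum z.
pose rho := mscale (NngNum (ltW a0)) (@tail_measure R).
have rhoG z : rho `[z, +oo[%classic = (G z)%:E.
  by rewrite /rho /mscale /= [X in (_ * X)%E]tail_measure_itv.
have Gd : exp_dominated G.
  have [cT [A TA]] := dom; split; first by move=> z; apply: cvgMr; exact: cT.
  exists (N^-1 * A) => z; have /andP[h1 h2] := TA z.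
  by rewrite /G mulr_ge0 ?(ltW a0)//= -mulrA ler_pM2l.
have G0 z : 0 < G z by rewrite mulr_gt0// tail_sum_gt0.
have Gn x y : x <= y -> G y <= G x by move=> xy; rewrite ler_pM2l// tail_sum_nonincr.
have Gst x y : 0 <= x -> x < y -> G y < G x.
  by move=> x0 xy; rewrite ltr_pM2l// tail_sum_decr.
have Gnorm : iter_tail m.+1 G 0 = 1.
  by rewrite iter_tailZ// ?(ltW a0)// mulVf// gt_eqF.
have Gder : {ae (@lebesgue_measure R), forall x : R, is_derive x (1 : R) G (0 : R)}.
  have := @tail_sum_derive R; apply: negligibleS => x /=; apply: contra_not => h.
  by have := is_deriveZ (N^-1) h; rewrite scaler0.
have [mE rhoE] := @tail_measure_grid_set R.
have E0 : (@lebesgue_measure R) (\bigcup_i grid_set i) = 0%E.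
  apply/eqP; rewrite eq_le measure_ge0 andbT.
  apply: (le_trans (measure_sigma_subadditive _ _ _ (@subset_refl _ _))) => //.
    by move=> i; exact: grid_set_measurable.
  by rewrite eseries0// => i _ _; exact: grid_set_null.
have rhoE' : rho (~` (\bigcup_i grid_set i)) = 0%E.
  by rewrite /rho /mscale [X in (_ * X)%E]rhoE mule0.
exists (psi1 G m); split; first exact: psi1_arch_gen.
exists (arch_prob Gd G0 Gnorm rhoG); split; first exact: arch_law_is_measure_of.
split; [split|split; [|split]].
- exact: (arch_law_singular Gd G0 Gn Gnorm rhoG mE E0 rhoE').
- exact: arch_law_set1.
- exact: arch_law_full_support.
- exact: arch_law_kernel.
- by move=> t _; exact: arch_law_level_set.
- rewrite (_ : kendall_df _ _ = cop_df G m rho); first exact: cop_df_cont_strict_singular.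
  by apply/funext => t; exact: kendall_dfE.
Qed.
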